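(* Consider the hierarchical Gaussian $K$-armed bandit and the algorithm HierTS described in the context, run for $n$ rounds. Let $c > 0$ be a constant such that $c\, \hat{\sigma}_{t,i}^{-2} \geq \hat{\sigma}_{t+1,i}^{-2}$ holds for every node $i \in \mathcal{V}$ and every round $t$. For any $\delta \in (0,1]$, the Bayes regret of HierTS satisfies \[ \mathcal{BR}(n) \leq \sqrt{2 n \mathcal{G}(n) \log(1/\delta)} + \sqrt{2/\pi}\, \sigma_{\max} K n \delta\,, \] where $\mathcal{G}(n) = \sum_{i \in \mathcal{V}} c^{h_i} w_i$, with \[ w_i = \frac{\sigma_{0,i}^2}{\log\big(1 + \sigma_{0,i}^2/\sigma^2\big)} \log\Big(1 + \frac{\sigma_{0,i}^2 n}{\sigma^2}\Big) \] for an action node $i$ (for which $h_i = 0$), and \[ w_i = \frac{\sigma_{0,i}^2}{\log\big(1 + \sigma_{0,i}^2/\sigma^2\big)} \log\Big(1 + \sigma_{0,i}^2 \sum_{j \in \mathsf{ch}(i)} \sigma_{0,j}^{-2}\Big) \] for a non-action node $i$ (for which $h_i > 0$).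
   Context: Tree and model. Let $\mathcal{T}$ be a rooted tree with node set $\mathcal{V}$, root labeled $1$, in which every internal node has at least $2$ children. For a node $i \neq 1$, $\mathsf{pa}(i)$ is its parent; $\mathsf{ch}(i)$ is the set of children of $i$. The leaves form the action set $\mathcal{A}$, $|\mathcal{A}| = K$. The height $h_i$ of node $i$ is the maximum length of a path from $i$ down to a leaf descendant (leaves have height $0$). Node parameters $\theta_{*, i} \in \mathbb{R}$ are generated as $\theta_{*, 1} \sim \mathcal{N}(\mu_1, \sigma_{0,1}^2)$ and, for $i \neq 1$, $\theta_{*, i} \mid \theta_{*, \mathsf{pa}(i)} \sim \mathcal{N}(\theta_{*, \mathsf{pa}(i)}, \sigma_{0,i}^2)$, with known $\mu_1$ and $\sigma_{0,i} > 0$. In each round $t = 1,\dots,n$ the agent takes $A_t \in \mathcal{A}$ and observes $Y_t \sim \mathcal{N}(\theta_{*, A_t}, \sigma^2)$ (independent noise, known $\sigma > 0$). The history is $H_t = (A_\ell, Y_\ell)_{\ell < t}$. Algorithm HierTS. In each round $t$, HierTS draws $\Theta_t = (\theta_{t,i})_{i \in \mathcal{V}}$ exactly from the posterior of $(\theta_{*,i})_{i \in \mathcal{V}}$ given $H_t$ (root from its posterior, then each node from its posterior conditioned on $H_t$ and the sampled parent value), takes $A_t = \arg\max_{a \in \mathcal{A}} \theta_{t,a}$, and observes $Y_t$. Bayes regret. With $A_* = \arg\max_{a} \theta_{*, a}$, $\mathcal{BR}(n) = \mathbb{E}\big[\sum_{t=1}^n (\theta_{*, A_*} - \theta_{*,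 A_t})\big]$, expectation over $\Theta_*$, rewards and algorithm randomness. $\sigma_{\max} = \max_{a \in \mathcal{A}} \sqrt{\mathrm{Var}(\theta_{*,a})} = \max_{a} \big(\sum_{j \in \psi_a} \sigma_{0,j}^2\big)^{1/2}$, where $\psi_a$ is the set of nodes on the path from the root to $a$ (inclusive). Conditional posterior variances. For a node $i \neq 1$, $\hat{\sigma}_{t,i}^2$ is the variance of $\theta_{*, i}$ conditioned on $H_t$ and on $\theta_{*, \mathsf{pa}(i)}$ (independent of the parent's value); for the root, $\hat{\sigma}_{t,1}^2 = \mathrm{Var}(\theta_{*,1} \mid H_t)$. Explicitly, with $\mathcal{S}_{t,a} = \{\ell < t : A_\ell = a\}$: for an action node $a$, $\hat{\sigma}_{t,a}^{-2} = \sigma_{0,a}^{-2} + |\mathcal{S}_{t,a}| \sigma^{-2}$; for a non-action node $i$, $\hat{\sigma}_{t,i}^{-2} = \sigma_{0,i}^{-2} + \sum_{j \in \mathsf{ch}(i)} \tilde{\sigma}_{t,j}^{-2}$, where recursively $\tilde{\sigma}_{t,j}^{2} = \sigma_{0,j}^2 + \sigma^2/|\mathcal{S}_{t,j}|$ for an action node $j$ (with $\tilde{\sigma}_{t,j}^{-2} = 0$ if $|\mathcal{S}_{t,j}| = 0$) and $\tilde{\sigma}_{t,j}^{2} = \sigma_{0,j}^2 + \big(\sum_{k \in \mathsf{ch}(j)} \tilde{\sigma}_{t,k}^{-2}\big)^{-1}$ for a non-action node $j$. *)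

(* Defs.v *)
From HB Require Import structures.
From mathcomp Require Import all_boot all_order all_algebra.
From mathcomp Require Import all_classical all_reals all_analysis.
Set Implicit Arguments. Unset Strict Implicit. Unset Printing Implicit Defensive.
Import Order.TTheory GRing.Theory Num.Theory.
Import numFieldNormedType.Exports.

Local Open Scope ring_scope.

Section Tree.
Context {V : finType} (root : V) (pa : V -> V).

Definition children (i : V) : {set V} := [set j | (j != root) && (pa j == i)].

Definition is_leaf (i : V) : bool := (#|children i| == 0)%N.

Definition leaves : {set V} := [set a | is_leaf a].

Definition is_rooted_tree : Prop :=
  [/\ pa root = root,
      (forall i : V, exists k : nat, iter k pa i = root) &
      (forall i : V, (0 < #|children i|)%N -> (1 < #|children i|)%N)].

(* height h_i : computed with fuel; #|V| fuel is enough since every path in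
   the tree has length < #|V|. *)
Fixpoint height_fuel (k : nat) (i : V) : nat :=
  match k with
  | 0 => 0
  | k'.+1 => if is_leaf i then 0
             else (\max_(j in children i) height_fuel k' j).+1
  end.
Definition height (i : V) : nat := height_fuel #|V| i.

Definition on_path (a j : V) : bool := [exists k : 'I_#|V|, iter k pa a == j].

End Tree.

Section Bandit.
Context {R : realType} {V : finType}.
Variables (root : V) (pa : V -> V) (mu1 : R) (sigma0 : V -> R) (sigma : R).

(* Statistic S_j (given pull counts N) : N_j / sigma^2 for an action node,
   and the sum over children k of tilde-sigma_k^{-2} otherwise; then
   tilde-sigma_j^{-2} = S_j / (1 + sigma0_j^2 S_j), which equals
   (sigma0_j^2 + 1/S_j)^{-1} when S_j > 0 and 0 when S_j = 0. *)
Fixpoint stat_fuel (k : nat) (N : V -> nat) (j : V) : R :=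
  match k with
  | 0 => 0
  | k'.+1 =>
    if is_leaf root pa j then (N j)%:R / sigma ^+ 2
    else \sum_(l in children root pa j)
           (stat_fuel k' N l / (1 + sigma0 l ^+ 2 * stat_fuel k' N l))
  end.

Definition hat_prec (N : V -> nat) (i : V) : R :=
  (sigma0 i ^+ 2)^-1 + stat_fuel #|V| N i.

(* prior density of Theta_* (sigma0 i is a standard deviation) *)
Definition prior_pdf (th : V -> R) : R :=
  \prod_(i : V) (if i == root then normal_pdf mu1 (sigma0 i) (th i)
                 else normal_pdf (th (pa i)) (sigma0 i) (th i)).

Definition likelihood (h : seq (V * R)) (th : V -> R) : R :=
  \prod_(p <- h) normal_pdf (th p.1) sigma p.2.

Fixpoint int_seq (s : seq V) (f : (V -> R) -> R) (x : V -> R) : R :=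
  match s with
  | [::] => f x
  | i :: s' => \int[@lebesgue_measure R]_(y in [set: R])
                 int_seq s' f (fun j => if j == i then y else x j)
  end.
Definition int_V (f : (V -> R) -> R) : R := int_seq (enum V) f (fun _ => 0).

Definition post_expect (h : seq (V * R)) (f : (V -> R) -> R) : R :=
  int_V (fun th => f th * prior_pdf th * likelihood h th)
  / int_V (fun th => prior_pdf th * likelihood h th).

Definition best (th : V -> R) : V :=
  if [pick a in leaves root pa] is Some a0
  then [arg max_(i > a0 in leaves root pa) th i]%O else root.

Fixpoint regret_to_go (k : nat) (th_s : V -> R) (h : seq (V * R)) : R :=
  match k with
  | 0 => 0
  | k'.+1 =>
    post_expect h (fun th =>
      let a := best th in
      (th_s (best th_s) - th_s a)
      + \int[@lebesgue_measure R]_(y in [set: R])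
          (normal_pdf (th_s a) sigma y * regret_to_go k' th_s (rcons h (a, y))))
  end.

Definition bayes_regret (n : nat) : R :=
  int_V (fun th_s => prior_pdf th_s * regret_to_go n th_s [::]).

Definition sigma_max : R :=
  \big[Num.max/0]_(a in leaves root pa)
     Num.sqrt (\sum_(j | on_path pa a j) sigma0 j ^+ 2).

Definition w_node (n : nat) (i : V) : R :=
  sigma0 i ^+ 2 / ln (1 + sigma0 i ^+ 2 / sigma ^+ 2) *
  ln (1 + (if is_leaf root pa i then sigma0 i ^+ 2 * n%:R / sigma ^+ 2
           else sigma0 i ^+ 2 *
                \sum_(j in children root pa i) (sigma0 j ^+ 2)^-1)).

Definition G_n (c : R) (n : nat) : R :=
  \sum_(i : V) c ^+ height root pa i * w_node n i.

End Bandit.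

(* Main.v *)
(* Given the history, the prior density times the likelihood factors,
   by completing the square at every node, as a constant times a product of
   Gaussian conditionals along the tree; hence every posterior marginal is
   Gaussian, with a variance that depends only on the pull counts. Given the
   history, the sampled action and the optimal action have the same law, so the
   posterior means cancel in the expected one-step regret, which is therefore at
   most the expectation of [sqrt (2 log (1/delta))] times the posterior standard
   deviation of the chosen action, plus a Gaussian tail of order [delta] per
   action. The variance of the chosen action is bounded by the decrease of a
   potential, a weighted sum over the nodes of logarithms of conditional posterior
   precisions: pulling [a] increases the precision of every ancestor of [a], and
   each step up the tree loses at most a factor [c]. The inequality
   [2 t <= lam t^2 + 1/lam] replaces the Cauchy-Schwarz inequality, which lets the
   bound be proved by induction on the number of remaining rounds; [lam] is
   optimized at the end. *)
Require Import Defs.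
From HB Require Import structures.
From mathcomp Require Import all_boot all_order all_algebra.
From mathcomp Require Import all_classical all_reals all_analysis.
From mathcomp Require Import measurable_realfun ring lra zify.
Import Order.TTheory GRing.Theory Num.Theory.
Import numFieldNormedType.Exports.
Local Open Scope ring_scope.

Set Implicit Arguments.
Unset Strict Implicit.
Unset Printing Implicit Defensive.
Local Open Scope classical_set_scope.
Local Open Scope ring_scope.

(** * Iterated integrals over node parameters *)

Section IteratedIntegral.
Context {R : realType} {V : finType}.
Local Notation mu := (@lebesgue_measure R).
Local Notation state := (V -> R).

(** Posterior expectations and the regret are iterated real integrals, and a real integral whose
    value is infinite is 0 by convention. To avoid proving integrability at every stage, the
    computations take place in [eint], with nonnegative integrands and extended real values, where
    Tonelli asks for measurability only. The truncated integral lies below [eint], which is the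
    direction an upper bound needs; equality is required only for the normalizing constant of the
    posterior, which stands in a denominator.

    The induction is stated for the unnormalized joint density of parameters and history rather than
    for the posterior. Multiplying by the density of the next reward gives the joint density of the
    longer history, so integrating out that reward is a change of order of integration, and
    normalizing constants of different histories are never compared. The bound has to leave this
    integral, so it must not depend on rewards; posterior variances depend on pull counts only, and
    so does the potential. *)

Definition upd (x : state) (i : V) (y : R) : state :=
  fun j => if j == i then y else x j.

Lemma upd_same x i y : upd x i y i = y.
Proof. by rewrite /upd eqxx. Qed.

Lemma upd_neq x i y k : k != i -> upd x i y k = x k.
Proof. by rewrite /upd => /negbTE ->. Qed.

Lemma upd_comm x i j y z : i != j ->
  upd (upd x i y) j z = upd (upd x j z) i y.
Proof.
move=> ij; apply/funext => k; rewrite /upd; case: eqVneq => [->|//].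
by rewrite eq_sym (negbTE ij).
Qed.

Definition coord_meas d (T : measurableType d) (phi : T -> state) :=
  forall i, measurable_fun setT (fun t => phi t i).

(* [V -> R] carries no sigma-algebra: measurability of a function on it is
   tested along all coordinatewise measurable families. *)
Definition jmeas d (T : measurableType d) d2 (U : sigmaRingType d2)
    (F : T -> state -> U) :=
  forall d' (T' : measurableType d') (u : T' -> T) (phi : T' -> state),
    measurable_fun setT u -> coord_meas phi ->
    measurable_fun setT (fun t => F (u t) (phi t)).

Definition cmeas d2 (U : sigmaRingType d2) (f : state -> U) :=
  forall d (T : measurableType d) (phi : T -> state),
    coord_meas phi -> measurable_fun setT (fun t => f (phi t)).

Lemma cmeas_jmeas d (T : measurableType d) d2 (U : sigmaRingType d2)
    (f : state -> U) : cmeas f -> jmeas (fun _ : T => f).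
Proof. by move=> mf d' T' u phi _; exact: mf. Qed.

Lemma jmeas_cmeas d (T : measurableType d) d2 (U : sigmaRingType d2)
    (F : T -> state -> U) t : jmeas F -> cmeas (F t).
Proof. by move=> mF d' T' phi mphi; exact: (mF _ _ (fun _ => t)). Qed.

Lemma coord_meas_cst d (T : measurableType d) (x : state) :
  coord_meas (fun _ : T => x).
Proof. by move=> i; exact: measurable_cst. Qed.

Lemma coord_meas_upd d (T : measurableType d) (phi : T -> state) i
    (y : T -> R) : coord_meas phi -> measurable_fun setT y ->
  coord_meas (fun t => upd (phi t) i (y t)).
Proof.
by move=> mphi my j; rewrite /upd; case: eqP => _; [exact: my|exact: mphi].
Qed.

Lemma coord_meas_comp d (T : measurableType d) d' (T' : measurableType d')
    (u : T' -> T) (phi : T -> state) : coord_meas phi ->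
  measurable_fun setT u -> coord_meas (fun t => phi (u t)).
Proof. by move=> mphi mu i; exact: (measurableT_comp (mphi i) mu). Qed.

Lemma measurable_upd d2 (U : sigmaRingType d2) (f : state -> U) x i :
  cmeas f -> measurable_fun setT (fun y : R => f (upd x i y)).
Proof.
move=> mf; apply: mf; apply: coord_meas_upd; first exact: coord_meas_cst.
exact: measurable_id.
Qed.

(** The untruncated counterpart of [int_seq]; the last node of the list is the innermost
    variable. *)
Fixpoint eint (s : seq V) (f : state -> \bar R) (x : state) : \bar R :=
  if s is i :: s' then (\int[mu]_y eint s' f (upd x i y))%E else f x.

Lemma eint_ge0 s f x : (forall x, 0 <= f x)%E -> (0 <= eint s f x)%E.
Proof.
by move=> f0; elim: s x => //= i s IH x; apply: integral_ge0 => y _; exact: IH.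
Qed.

Lemma jmeas_integral d (T : measurableType d) (F : T -> state -> \bar R) i :
  (forall t x, 0 <= F t x)%E -> jmeas F ->
  jmeas (fun t x => \int[mu]_y F t (upd x i y))%E.
Proof.
move=> F0 mF d' T' u phi mphi0 mphi.
apply: (measurable_fun_fubini_tonelli_F (m2 := mu)
  (fun p : T' * R => F (u p.1) (upd (phi p.1) i p.2))) => //.
apply: (mF _ _ (fun p : T' * R => u p.1)
  (fun p : T' * R => upd (phi p.1) i p.2)).
  by apply: measurableT_comp => //; exact: measurable_fst.
apply: coord_meas_upd; last exact: measurable_snd.
by apply: coord_meas_comp => //; exact: measurable_fst.
Qed.

Lemma jmeas_eint d (T : measurableType d) (F : T -> state -> \bar R) s :
  (forall t x, 0 <= F t x)%E -> jmeas F -> jmeas (fun t x => eint s (F t) x).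
Proof.
move=> F0 mF; elim: s => [//|i s IH].
by apply: jmeas_integral IH => t x; exact: eint_ge0.
Qed.

Lemma measurable_eint d (T : measurableType d) (F : T -> state -> \bar R) s x :
  (forall t x, 0 <= F t x)%E -> jmeas F ->
  measurable_fun setT (fun t => eint s (F t) x).
Proof.
move=> F0 mF; apply: (@jmeas_eint d T F s F0 mF d T idfun (fun=> x)).
  exact: measurable_id.
exact: coord_meas_cst.
Qed.

Lemma cmeas_eint s (f : state -> \bar R) :
  (forall x, 0 <= f x)%E -> cmeas f -> cmeas (eint s f).
Proof.
move=> f0 mf; apply: (@jmeas_cmeas _ unit _ _ (fun _ => eint s f) tt).
by apply: jmeas_eint => //; exact: cmeas_jmeas.
Qed.

Lemma le_eint s (f g : state -> \bar R) x : (forall x, 0 <= f x)%E ->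
  cmeas f -> cmeas g -> (forall x, f x <= g x)%E ->
  (eint s f x <= eint s g x)%E.
Proof.
move=> f0 mf mg fg; have g0 y : (0 <= g y)%E by exact: le_trans (fg y).
elim: s x => //= i s IH x; apply: ge0_le_integral => //.
- by move=> y _; exact: eint_ge0.
- by apply: measurable_upd; exact: cmeas_eint.
- by apply: measurable_upd; exact: cmeas_eint.
Qed.

Lemma eint_add s (f g : state -> \bar R) x : (forall x, 0 <= f x)%E ->
  (forall x, 0 <= g x)%E -> cmeas f -> cmeas g ->
  (eint s (fun x => f x + g x) x = eint s f x + eint s g x)%E.
Proof.
move=> f0 g0 mf mg; elim: s x => //= i s IH x.
under eq_integral do rewrite IH.
rewrite ge0_integralD //.
- by move=> y _; exact: eint_ge0.
- by apply: measurable_upd; exact: cmeas_eint.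
- by move=> y _; exact: eint_ge0.
- by apply: measurable_upd; exact: cmeas_eint.
Qed.

Lemma eint_scale s (k : \bar R) (f : state -> \bar R) x : (0 <= k)%E ->
  (forall x, 0 <= f x)%E -> cmeas f ->
  (eint s (fun x => k * f x) x = k * eint s f x)%E.
Proof.
move=> k0 f0 mf; elim: s x => //= i s IH x.
under eq_integral do rewrite IH.
rewrite ge0_integralZl //.
- by apply: measurable_upd; exact: cmeas_eint.
- by move=> y _; exact: eint_ge0.
Qed.

Lemma eq_eint s (f g : state -> \bar R) x : f =1 g -> eint s f x = eint s g x.
Proof. by move=> /funext ->. Qed.

Lemma eint_cat s1 s2 f x : eint (s1 ++ s2) f x = eint s1 (eint s2 f) x.
Proof.
by elim: s1 x => //= i s IH x; apply: eq_integral => y _; rewrite IH.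
Qed.

Lemma eint_swap i j f x : i != j -> (forall x, 0 <= f x)%E -> cmeas f ->
  eint [:: i; j] f x = eint [:: j; i] f x.
Proof.
move=> ij f0 mf /=.
apply: etrans (fubini_tonelli (m1 := mu) (m2 := mu)
    (fun p : R * R => f (upd (upd x i p.1) j p.2)) _ _) _ => //=; last first.
  by apply: eq_integral => y _; apply: eq_integral => z _; rewrite upd_comm.
apply: mf; apply: coord_meas_upd; last exact: measurable_snd.
by apply: coord_meas_upd;[exact: coord_meas_cst|exact: measurable_fst].
Qed.

Lemma eint_rcons_cons s i f x : i \notin s -> (forall x, 0 <= f x)%E ->
  cmeas f -> eint (i :: s) f x = eint (rcons s i) f x.
Proof.
elim: s x => // j s IH x; rewrite inE negb_or => /andP[ij is'] f0 mf.
rewrite rcons_cons -[RHS]/(\int[mu]_y eint (rcons s i) f (upd x j y))%E.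
under [RHS]eq_integral do rewrite -IH//.
rewrite -[LHS]/(eint [:: i; j] (eint s f) x) eint_swap//.
- by move=> y; exact: eint_ge0.
- exact: cmeas_eint.
Qed.

(** Tonelli by adjacent swaps. It replaces the order [enum V] imposed by [int_V] with one compatible
    with the tree. *)
Lemma eint_perm s1 s2 f x : perm_eq s1 s2 -> uniq s1 ->
  (forall x, 0 <= f x)%E -> cmeas f -> eint s1 f x = eint s2 f x.
Proof.
move=> ps us f0 mf; elim: s1 s2 x ps us => [|i s IH] s2 x ps /=.
  by move: ps; rewrite perm_sym => /perm_nilP ->.
case/andP=> nis us.
have : i \in s2 by rewrite -(perm_mem ps) inE eqxx.
move=> /splitPr def2; case: def2 ps => p1 p2 ps.
have ps' : perm_eq s (p1 ++ p2).
  by rewrite -(perm_cons i); apply: (perm_trans ps); rewrite -cat1s perm_catCA.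
have ip1 : i \notin p1.
  by move: nis; rewrite (perm_mem ps') mem_cat negb_or => /andP[].
rewrite eint_cat -[eint (i :: p2) f]/(eint ([:: i] ++ p2) f).
rewrite (_ : eint ([:: i] ++ p2) f = eint [:: i] (eint p2 f)); last first.
  by apply/funext => z; rewrite eint_cat.
rewrite -eint_cat cats1 -eint_rcons_cons//.
- by apply: eq_integral => y _; rewrite (IH (p1 ++ p2))// eint_cat.
- by move=> z; exact: eint_ge0.
- exact: cmeas_eint.
Qed.

Lemma eint_integral s (f : R -> state -> \bar R) x : (forall y x, 0 <= f y x)%E ->
  jmeas f ->
  (eint s (fun x => \int[mu]_y f y x) x = \int[mu]_y eint s (f y) x)%E.
Proof.
move=> f0 mf; elim: s x => //= i s IH x.
under eq_integral do rewrite IH.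
apply: (fubini_tonelli (m1 := mu) (m2 := mu)
  (fun p : R * R => eint s (f p.2) (upd x i p.1))) => /=.
- have := @jmeas_eint _ _ _ s f0 mf.
  move/(_ _ _ (fun p : R * R => p.2) (fun p : R * R => upd x i p.1)); apply.
    exact: measurable_snd.
  by apply: coord_meas_upd;[exact: coord_meas_cst|exact: measurable_fst].
- by move=> p; exact: eint_ge0.
Qed.

Lemma int_seq0 (s : seq V) (x : state) : int_seq s (fun=> 0) x = 0.
Proof.
elim: s x => //= i s IH x.
by under eq_Rintegral do rewrite IH; rewrite /Rintegral integral0.
Qed.

Lemma int_seq_ge0 s (f : state -> R) x : (forall x, 0 <= f x) ->
  0 <= int_seq s f x.
Proof.
by move=> f0; elim: s x => //= i s IH x; apply: Rintegral_ge0 => y _; exact: IH.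
Qed.

Lemma jmeas_EFin d (T : measurableType d) (F : T -> state -> R) :
  jmeas F -> jmeas (fun t x => (F t x)%:E).
Proof.
by move=> mF d' T' u phi mu mphi; apply/measurable_EFinP; exact: mF.
Qed.

Lemma cmeas_EFin (f : state -> R) : cmeas f -> cmeas (fun x => (f x)%:E).
Proof. by move=> mF d' T' phi mphi; apply/measurable_EFinP; exact: mF. Qed.

Lemma jmeas_int_seq d (T : measurableType d) (F : T -> state -> R) s :
  (forall t x, 0 <= F t x) -> jmeas F -> jmeas (fun t x => int_seq s (F t) x).
Proof.
move=> F0 mF; elim: s => [//|i s IH] d' T' u phi mphi0 mphi.
apply: (measurableT_comp (fine_measurable measurableT)).
apply: (jmeas_integral (F := fun t x => (int_seq s (F t) x)%:E)) => //.
- by move=> t x; rewrite lee_fin; exact: int_seq_ge0.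
- exact: jmeas_EFin.
Qed.

Lemma cmeas_int_seq s (f : state -> R) :
  (forall x, 0 <= f x) -> cmeas f -> cmeas (int_seq s f).
Proof.
move=> f0 mf; apply: (@jmeas_cmeas _ unit _ _ (fun _ => int_seq s f) tt).
by apply: jmeas_int_seq => //; exact: cmeas_jmeas.
Qed.

Lemma fine_le_ge0 (z : \bar R) : (0 <= z)%E -> ((fine z)%:E <= z)%E.
Proof. by case: z => //= _; rewrite leey. Qed.

(** Each real integral is the [fine] part of an extended one, and for nonnegative values [fine] can
    only lower the result. *)
Lemma int_seq_le_eint s (f : state -> R) x : (forall x, 0 <= f x) ->
  cmeas f -> ((int_seq s f x)%:E <= eint s (EFin \o f) x)%E.
Proof.
move=> f0 mf; elim: s x => //= i s IH x.
have i0 y : (0 <= (int_seq s f (upd x i y))%:E)%E.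
  by rewrite lee_fin; exact: int_seq_ge0.
apply: (@le_trans _ _ (\int[mu]_y (int_seq s f (upd x i y))%:E)%E).
  by apply: fine_le_ge0; apply: integral_ge0 => y _; exact: i0.
apply: ge0_le_integral => //.
- apply: (measurable_upd (f := fun x => (int_seq s f x)%:E)).
  by apply: cmeas_EFin; exact: cmeas_int_seq.
- apply: measurable_upd; apply: cmeas_eint; last exact: cmeas_EFin.
  by move=> y; rewrite lee_fin.
Qed.

(* The inner integrals of a finite iterated integral are finite almost
   everywhere, so truncating them with [fine] loses nothing. *)
Lemma int_seq_eint s (f : state -> R) x : (forall x, 0 <= f x) ->
  cmeas f -> (eint s (EFin \o f) x < +oo)%E ->
  (int_seq s f x)%:E = eint s (EFin \o f) x.
Proof.
move=> f0 mf; have F0 y : (0 <= (EFin \o f) y)%E by rewrite lee_fin.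
elim: s x => //= i s IH x fin.
have m1 : measurable_fun setT (fun y : R => eint s (EFin \o f) (upd x i y)).
  by apply: measurable_upd; apply: cmeas_eint => //; exact: cmeas_EFin.
have ge0 y : (0 <= eint s (EFin \o f) (upd x i y))%E by exact: eint_ge0.
have /integrable_ae ae : mu.-integrable setT
    (fun y : R => eint s (EFin \o f) (upd x i y)).
  apply/integrableP; split=> //.
  by under eq_integral do rewrite gee0_abs//.
have eqi : (\int[mu]_y (int_seq s f (upd x i y))%:E =
    \int[mu]_y eint s (EFin \o f) (upd x i y))%E.
  apply: ge0_ae_eq_integral => //.
  - apply: (measurable_upd (f := fun x => (int_seq s f x)%:E)).
    by apply: cmeas_EFin; exact: cmeas_int_seq.
  - by move=> y _; rewrite lee_fin; exact: int_seq_ge0.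
  - apply: filterS (ae measurableT) => y /= /(_ Logic.I) finy _.
    by apply: IH; rewrite ltey_eq finy.
rewrite /Rintegral eqi fineK// ge0_fin_numE//.
by apply: integral_ge0.
Qed.

End IteratedIntegral.

(** * One-dimensional Gaussian identities and tails *)

Section Gaussian.
Context {R : realType}.
Local Notation mu := (@lebesgue_measure R).
Implicit Types (m s t x y al be C : R).

Lemma normal_pdfE_expR m s x : 0 < s ->
  normal_pdf m s x = normal_peak s * expR (- (x - m) ^+ 2 / (s ^+ 2 *+ 2)).
Proof. by move=> s0; rewrite normal_pdfE// gt_eqF. Qed.

Lemma normal_peakM s s' t t' : 0 < s -> 0 < s' -> s * s' = t * t' ->
  normal_peak s * normal_peak s' = normal_peak t * normal_peak t'.
Proof.
move=> s0 s'0 e; have pi0 := pi_ge0 R.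
have h (u v : R) : normal_peak u * normal_peak v =
    (Num.sqrt ((u * v) ^+ 2 * (pi *+ 2) ^+ 2))^-1.
  rewrite /normal_peak -invfM -sqrtrM; last by rewrite mulrn_wge0// mulr_ge0// sqr_ge0.
  by congr (Num.sqrt _)^-1; ring.
by rewrite !h e.
Qed.

(** Bayes rule for a Gaussian [x] observed through [y = al * x + be] plus noise: the marginal
    density of [y] times the conditional density of [x] given [y]. *)
Lemma normal_pdf_conv_split m s al be s' t x y : 0 < s -> 0 < s' -> 0 < t ->
  t ^+ 2 = al ^+ 2 * s ^+ 2 + s' ^+ 2 ->
  normal_pdf m s x * normal_pdf (al * x + be) s' y =
  normal_pdf (al * m + be) t y *
  normal_pdf ((m * s' ^+ 2 + al * (y - be) * s ^+ 2) / t ^+ 2) (s * s' / t) x.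
Proof.
move=> s0 s'0 t0 tE; have st0 : 0 < s * s' / t by rewrite divr_gt0// mulr_gt0.
rewrite !normal_pdfE_expR// mulrACA [RHS]mulrACA -!expRD.
congr (_ * expR _).
  by apply: normal_peakM => //; field; rewrite gt_eqF.
have [s1 s'1 t1] : [/\ s != 0, s' != 0 & t != 0] by rewrite !gt_eqF.
have -> : (s * s' / t) ^+ 2 = s ^+ 2 * s' ^+ 2 / t ^+ 2 by field.
rewrite tE; have : al ^+ 2 * s ^+ 2 + s' ^+ 2 != 0 by rewrite -tE expf_neq0.
by move=> h; field; rewrite s1 s'1 exprMn h.
Qed.

Lemma integral_normal_conv m s al be s' t y : 0 < s -> 0 < s' -> 0 < t ->
  t ^+ 2 = al ^+ 2 * s ^+ 2 + s' ^+ 2 ->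
  (\int[mu]_x (normal_pdf m s x * normal_pdf (al * x + be) s' y)%:E =
   (normal_pdf (al * m + be) t y)%:E)%E.
Proof.
move=> s0 s'0 t0 tE.
under eq_integral => x _ do
  rewrite (normal_pdf_conv_split _ _ _ _ s0 s'0 t0 tE) EFinM.
rewrite ge0_integralZl//.
- by rewrite integral_normal_pdf mule1.
- by apply/measurable_EFinP; exact: measurable_normal_pdf.
- by move=> x _; rewrite lee_fin normal_pdf_ge0.
- by rewrite lee_fin normal_pdf_ge0.
Qed.

Lemma normal_pdf_cvgy m s : 0 < s -> normal_pdf m s x @[x --> +oo] --> (0 : R).
Proof.
move=> s0.
pose r := Num.sqrt (s ^+ 2 *+ 2); have r0 : 0 < r.
  by rewrite sqrtr_gt0 pmulrn_lgt0// exprn_gt0.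
have -> : normal_pdf m s = fun x => normal_peak s * gauss_fun ((x - m) / r).
  apply/funext => x; rewrite normal_pdfE_expR// /gauss_fun; congr (_ * expR _).
  by rewrite expr_div_n sqr_sqrtr ?mulNr// mulrn_wge0// sqr_ge0.
rewrite -[X in _ --> X](mulr0 (normal_peak s)); apply: cvgMl_tmp.
apply: (cvg_comp (fun x => (x - m) / r) _ _ cvg_gauss_fun).
apply: gt0_cvgMly; last exact: cvg_addrr.
by rewrite invr_gt0.
Qed.

Lemma is_derive_normal_pdf m s x : 0 < s ->
  is_derive x 1 (fun z => - (s ^+ 2) * normal_pdf m s z)
    ((x - m) * normal_pdf m s x).
Proof.
move=> s0.
have -> : (fun z => - (s ^+ 2) * normal_pdf m s z) =
  (fun z => (- (s ^+ 2) * normal_peak s) *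
            expR ((- (2 * s ^+ 2)^-1) * ((z - m) * (z - m)))).
  apply/funext => z; rewrite normal_pdfE_expR// mulrA; congr (_ * expR _).
  by field; rewrite gt_eqF.
apply: is_derive_eq; rewrite normal_pdfE_expR// /GRing.scale/=.
have -> : - (2 * s ^+ 2)^-1 * ((x - m) * (x - m)) =
          - (x - m) ^+ 2 / (s ^+ 2 *+ 2) by field; rewrite gt_eqF.
by field; rewrite gt_eqF.
Qed.

(** The function [- s ^+ 2 * normal_pdf m s] is an antiderivative of the integrand and vanishes at
    infinity. *)
Lemma integral_normal_tail m s C : 0 < s -> 0 <= C ->
  (\int[mu]_(x in `[(m + C)%R, +oo[) ((x - m) * normal_pdf m s x)%:E =
   (s ^+ 2 * normal_pdf m s (m + C))%:E)%E.
Proof.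
move=> s0 C0.
have cN : continuous (normal_pdf m s).
  by apply: continuous_normal_pdf; rewrite gt_eqF.
rewrite (@ge0_continuous_FTC2y _ _ (fun z => - (s ^+ 2) * normal_pdf m s z) _ 0).
- by rewrite -EFinB sub0r mulNr opprK.
- move=> x; rewrite -lerBrDl => h.
  by rewrite mulr_ge0 ?normal_pdf_ge0// (le_trans C0).
- apply: continuous_subspaceT => x; apply: cvgM; last exact: cN.
  apply: (@cvgB _ R^o); [exact: cvg_id|exact: cvg_cst].
- rewrite -[X in _ --> X](mulr0 (- (s ^+ 2))); apply: cvgMl_tmp.
  exact: normal_pdf_cvgy.
- by move=> x _; apply: (@ex_derive _ _ _ _ _ _ _ (is_derive_normal_pdf m x s0)).
- by apply: cvg_at_right_filter; apply: cvgMl_tmp; exact: cN.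
- move=> x _; rewrite derive1E.
  exact: (@derive_val _ _ _ _ _ _ _ (is_derive_normal_pdf m x s0)).
Qed.

(** On [x >= m + C] the excess [x - m - C] is replaced by the larger [x - m], whose integral is
    explicit. *)
Lemma normal_tail_le m s C : 0 < s -> 0 <= C ->
  (\int[mu]_x (normal_pdf m s x * Num.max (x - m - C) 0)%:E <=
   (s ^+ 2 * normal_pdf m s (m + C))%:E)%E.
Proof.
move=> s0 C0; rewrite -integral_normal_tail// [leRHS]integral_mkcond.
apply: ge0_le_integral => //.
- by move=> x _; rewrite lee_fin mulr_ge0 ?normal_pdf_ge0// le_max lexx orbT.
- apply/measurable_EFinP; apply: measurable_funM.
    exact: measurable_normal_pdf.
  by apply: measurable_maxr => //; apply: measurable_funB => //; exact: measurable_funB.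
- apply/(measurable_restrictT _ _).1 => //.
  apply/measurable_EFinP; apply: measurable_funM; first exact: measurable_funB.
  by apply: measurable_funTS; exact: measurable_normal_pdf.
- move=> x _; rewrite patchE.
  case: (leP (m + C) x) => h.
    rewrite mem_set/= ?in_itv/= ?andbT//; move: h; rewrite -lerBrDl => h.
    rewrite lee_fin mulrC ler_wpM2r ?normal_pdf_ge0//.
    by rewrite ge_max gerBl C0 (le_trans C0 h).
  rewrite memNset/= ?in_itv/= ?andbT; last by apply/negP; rewrite -ltNge.
  by rewrite lee_fin max_r ?mulr0// subr_le0 lerBlDl ltW.
Qed.

Lemma normal_pospart m s : 0 < s ->
  (\int[mu]_x (normal_pdf m s x * Num.max (x - m) 0)%:E =
   (s ^+ 2 * normal_pdf m s m)%:E)%E.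
Proof.
move=> s0; have := @integral_normal_tail m s 0 s0 (lexx _).
rewrite addr0 => <-; rewrite [RHS]integral_mkcond.
apply: eq_integral => x _; rewrite patchE.
case: (leP m x) => h.
  by rewrite mem_set/= ?in_itv/= ?andbT// mulrC max_l// subr_ge0.
rewrite memNset/= ?in_itv/= ?andbT; last by apply/negP; rewrite -ltNge.
by rewrite max_r ?mulr0// subr_le0 ltW.
Qed.

Lemma integral_oppr (f : R -> \bar R) : measurable_fun setT f ->
  (forall x, 0 <= f x)%E -> (\int[mu]_x f x = \int[mu]_x f (- x)%R)%E.
Proof.
move=> mf f0.
rewrite [RHS](_ : _ = \int[mu]_(x in (-%R : _ -> measurableTypeR R) @^-1` setT)
  f (- x)%R)%E; last by rewrite preimage_setT.
rewrite -ge0_integral_pushforward//=.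
by apply: eq_measure_integral => //= A mA _; exact/esym/lebesgue_measureN.
Qed.

Lemma normal_pdfN m s x : 0 < s -> normal_pdf m s (- x) = normal_pdf (- m) s x.
Proof.
move=> s0; rewrite !normal_pdfE_expR//.
by have -> : (- x - m) ^+ 2 = (x - - m) ^+ 2 by ring.
Qed.

(** Reflection reduces this to the positive part. The equality of the two values later allows a
    centred signed term to be removed using nonnegative integrands only. *)
Lemma normal_negpart m s : 0 < s ->
  (\int[mu]_x (normal_pdf m s x * Num.max (m - x) 0)%:E =
   (s ^+ 2 * normal_pdf m s m)%:E)%E.
Proof.
move=> s0; rewrite integral_oppr.
- rewrite -[in RHS](opprK m) normal_pdfN// opprK -normal_pospart//.
  by apply: eq_integral => x _; rewrite normal_pdfN// !opprK addrC.
- apply/measurable_EFinP; apply: measurable_funM.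
    exact: measurable_normal_pdf.
  by apply: measurable_maxr => //; exact: measurable_funB.
- by move=> x; rewrite lee_fin mulr_ge0 ?normal_pdf_ge0// le_max lexx orbT.
Qed.

Lemma normal_tail_peak m s C : 0 < s ->
  s ^+ 2 * normal_pdf m s (m + C) =
  s / Num.sqrt (pi *+ 2) * expR (- C ^+ 2 / (s ^+ 2 *+ 2)).
Proof.
move=> s0; rewrite normal_pdfE_expR// addrAC subrr add0r mulrA; congr (_ * _).
rewrite /normal_peak -mulrnAr sqrtrM ?sqr_ge0// sqrtr_sqr gtr0_norm//.
rewrite invfM expr2 !mulrA mulfK//; exact: lt0r_neq0.
Qed.

End Gaussian.

Lemma measurable_normal_pdf_fun (R : realType) d (T : measurableType d)
    (m y : T -> R) (s : R) : 0 < s ->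
  measurable_fun setT m -> measurable_fun setT y ->
  measurable_fun setT (fun t => normal_pdf (m t) s (y t)).
Proof.
move=> s0 mm my; under eq_fun do rewrite normal_pdfE_expR//.
apply: measurable_funM => //; apply: measurableT_comp => //.
apply: measurable_funM => //; apply: measurableT_comp => //.
by apply: measurable_funX; exact: measurable_funB.
Qed.

Lemma measurable_prod_seq (R : realType) d (T : measurableType d) (I : Type)
    (s : seq I) (f : I -> T -> R) :
  (forall i, measurable_fun setT (f i)) ->
  measurable_fun setT (fun t => \prod_(i <- s) f i t).
Proof.
move=> mf; elim: s => [|i s IH].
  by under eq_fun do rewrite big_nil; exact: measurable_cst.
by under eq_fun do rewrite big_cons; exact: measurable_funM.
Qed.

(** * Orders in which parents precede children *)

Section TreeOrder.
Context {V : finType} (root : V) (pa : V -> V).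

(** The list grows at its end because the innermost integral belongs to the last node: no earlier
    node depends on it, so it can be integrated out first. *)
Inductive topo : seq V -> Prop :=
| topo_nil : topo [::]
| topo_rcons s i : topo s -> i \notin s -> (pa i \in s) \/ (i = root) ->
    topo (rcons s i).

Hypothesis tree : is_rooted_tree root pa.

Lemma topo_pa s i : topo s -> i \in s -> pa i \in s.
Proof.
case: tree => paroot _ _; elim=> // s' j _ IH js' pj.
rewrite !mem_rcons !inE => /predU1P[->|/IH ->]; last by rewrite orbT.
by case: pj => [->|->]; rewrite ?orbT// paroot eqxx.
Qed.

Lemma topo_uniq s : topo s -> uniq s.
Proof. by elim=> // s' j _ us js' _; rewrite rcons_uniq js'. Qed.

(** Otherwise every ancestor of [i] would be missing from [s], in particular the root, which itself
    qualifies. *)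
Lemma topo_extend s i : topo s -> i \notin s ->
  exists2 j, j \notin s & (pa j \in s) \/ j = root.
Proof.
case: tree => paroot toroot _ ts nis; apply: contrapT => no.
have step k : iter k pa i \notin s.
  elim: k => //= k IH; apply/negP => h; apply: no.
  by exists (iter k pa i) => //; left.
case: (toroot i) => k ki; apply: no; exists root; last by right.
by rewrite -ki.
Qed.

Lemma topo_exists : exists2 s, topo s & perm_eq s (enum V).
Proof.
suff: forall k, exists2 s, topo s & (size s = k \/ forall i, i \in s).
  move=> /(_ #|V|.+1)[s ts [szs|all]].
    have := uniq_leq_size (topo_uniq ts) (fun x _ => mem_enum V x).
    by rewrite -cardE szs ltnn.
  exists s => //; apply: uniq_perm; rewrite ?enum_uniq ?topo_uniq// => i.
  by rewrite all mem_enum.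
elim=> [|k [s ts [sz|all]]]; first by exists [::];[constructor|left].
- case: (pselect (forall i, i \in s)) => [all|/existsNP[i /negP nis]].
    by exists s => //; right.
  have [j nj pj] := topo_extend ts nis.
  by exists (rcons s j); [constructor|left; rewrite size_rcons sz].
- by exists s => //; right.
Qed.

End TreeOrder.

(** * Linear Gaussian networks on a tree and their marginals *)

Section TreeGaussian.
Context {R : realType} {V : finType} (root : V) (pa : V -> V).
Variables (al be sg m t : V -> R).
Local Notation mu := (@lebesgue_measure R).
Local Notation state := (V -> R).

Hypothesis tree : is_rooted_tree root pa.
Hypothesis al0 : al root = 0.
Hypothesis sg0 : forall i, 0 < sg i.
Hypothesis t0 : forall i, 0 < t i.
Hypothesis tE : forall i, t i ^+ 2 = al i ^+ 2 * t (pa i) ^+ 2 + sg i ^+ 2.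
Hypothesis mE : forall i, m i = al i * m (pa i) + be i.

(** The root is its own parent; [al root = 0] makes its mean the constant [be root], so that it
    needs no separate formula. *)
Definition tg_node (i : V) (x : state) : R :=
  normal_pdf (al i * x (pa i) + be i) (sg i) (x i).

Definition tg_pdf (s : seq V) (x : state) : R := \prod_(i <- s) tg_node i x.

Lemma tg_pdf_ge0 s x : 0 <= tg_pdf s x.
Proof. by apply: prodr_ge0 => i _; exact: normal_pdf_ge0. Qed.

Lemma cmeas_tg_pdf s : cmeas (tg_pdf s).
Proof.
move=> d T phi mphi; apply: measurable_prod_seq => i.
apply: measurable_normal_pdf_fun => //.
by apply: measurable_funD => //; exact: measurable_funM.
Qed.

Lemma tg_pdf_rcons_upd s i x y : topo root pa s -> i \notin s ->
  (pa i \in s) \/ (i = root) ->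
  tg_pdf (rcons s i) (upd x i y) =
  tg_pdf s x * normal_pdf (al i * x (pa i) + be i) (sg i) y.
Proof.
move=> ts nis pi; rewrite /tg_pdf -cats1 big_cat big_seq1/=; congr (_ * _).
  rewrite !big_seq; apply: eq_bigr => j js.
  have ne k : k \in s -> upd x i y k = x k.
    by move=> ks; rewrite upd_neq//; apply: contraNneq nis => <-.
  by rewrite /tg_node !ne//; exact: (topo_pa tree ts js).
rewrite /tg_node upd_same; case: pi => [pis|->]; last by rewrite al0 !mul0r.
by rewrite upd_neq//; apply: contraNneq nis => <-.
Qed.

Lemma integral_tg_last s i x (g : R -> \bar R) : topo root pa s -> i \notin s ->
  (pa i \in s) \/ (i = root) -> measurable_fun setT g ->
  (forall y, 0 <= g y)%E ->
  (\int[mu]_y (g y * (tg_pdf (rcons s i) (upd x i y))%:E) =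
   (\int[mu]_y (g y * (normal_pdf (al i * x (pa i) + be i) (sg i) y)%:E))
   * (tg_pdf s x)%:E)%E.
Proof.
move=> ts nis pi mg g0.
under eq_integral => y _ do
  rewrite (tg_pdf_rcons_upd _ _ ts nis pi) mulrC EFinM muleA.
rewrite ge0_integralZr//.
- by apply: emeasurable_funM => //; apply/measurable_EFinP; exact: measurable_normal_pdf.
- by move=> y _; rewrite mule_ge0// lee_fin normal_pdf_ge0.
- by rewrite lee_fin tg_pdf_ge0.
Qed.

Lemma tg_mass s x : topo root pa s -> eint s (EFin \o tg_pdf s) x = 1%E.
Proof.
move=> ts; elim: ts x => [|s' i ts IH nis pi] x.
  by rewrite /= /tg_pdf big_nil.
rewrite -{1}cats1 eint_cat -[RHS](IH x); apply: eq_eint => {}x /=.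
have := integral_tg_last x ts nis pi (measurable_cst 1%E) (fun _ => lee01).
under eq_integral do rewrite mul1e.
by move=> ->; under eq_integral do rewrite mul1e; rewrite integral_normal_pdf mul1e.
Qed.

(** Nodes after [a] integrate to 1. When [a] is last, integrating it out turns [g] into a function
    of the parent's value, to which the induction hypothesis applies; this is why [g] is general.
    The two Gaussians are then merged by convolution. *)
Lemma tg_marginal s a x (g : R -> \bar R) : topo root pa s -> a \in s ->
  measurable_fun setT g -> (forall y, 0 <= g y)%E ->
  (eint s (fun th => g (th a) * (tg_pdf s th)%:E) x =
   \int[mu]_y (g y * (normal_pdf (m a) (t a) y)%:E))%E.
Proof.
move=> ts; elim: ts a g x => // s' i ts IH nis pi a g x.
rewrite mem_rcons inE -cats1 => /predU1P ai mg g0; rewrite eint_cat.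
have [eai|nai] := eqVneq a i; last first.
  have as' : a \in s' by case: ai => // eai; rewrite eai eqxx in nai.
  rewrite -(IH a g x)//; apply: eq_eint => {}x /=.
  have := integral_tg_last x ts nis pi (measurable_cst (g (x a))) (fun _ => g0 _).
  rewrite -cats1.
  under [in X in _ -> X]eq_integral => y _ do rewrite upd_neq//.
  move=> ->; congr (_ * _)%E; rewrite ge0_integralZl//.
  - by rewrite integral_normal_pdf mule1.
  - by apply/measurable_EFinP; exact: measurable_normal_pdf.
  - by move=> y _; rewrite lee_fin normal_pdf_ge0.
subst i; clear ai.
(* The conditional expectation of [g] at node [a], given that its parent has value [u]. *)
pose g' u := (\int[mu]_y (g y *
   (normal_pdf (al a * u + be a) (sg a) y)%:E))%E.
have g'0 u : (0 <= g' u)%E.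
  by apply: integral_ge0 => y _; rewrite mule_ge0// lee_fin normal_pdf_ge0.
have mjoint : measurable_fun setT (fun p : R * R =>
    (g p.2 * (normal_pdf (al a * p.1 + be a) (sg a) p.2)%:E)%E).
  apply: emeasurable_funM; first by apply: measurableT_comp => //; exact: measurable_snd.
  apply/measurable_EFinP; apply: measurable_normal_pdf_fun => //.
  by apply: measurable_funD => //; exact: measurable_funM.
have mg' : measurable_fun setT g'.
  apply: (measurable_fun_fubini_tonelli_F (m2 := mu)
   (fun p : R * R => (g p.2 * (normal_pdf (al a * p.1 + be a) (sg a) p.2)%:E)%E)) => //.
  by move=> p; rewrite mule_ge0// lee_fin normal_pdf_ge0.
have -> : eint [:: a] (fun th => g (th a) * (tg_pdf (s' ++ [:: a]) th)%:E)%E =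
    (fun x => g' (x (pa a)) * (tg_pdf s' x)%:E)%E.
  apply/funext => z /=; rewrite -integral_tg_last// -cats1.
  by apply: eq_integral => y _; rewrite upd_same.
(* At the root [g'] is constant and only the total mass of the remaining nodes is left. *)
case: pi => [pas|eroot]; last first.
  have g'c z : g' (z (pa a)) = g' 0.
    by rewrite /g' eroot al0; under eq_integral do rewrite mul0r -(mul0r 0).
  under eq_eint do rewrite g'c.
  rewrite eint_scale//; last 2 first.
  - by move=> z; rewrite lee_fin tg_pdf_ge0.
  - by apply: cmeas_EFin; exact: cmeas_tg_pdf.
  rewrite tg_mass// mule1 /g'; apply: eq_integral => y _.
  rewrite mE eroot al0 !mul0r; congr (_ * (normal_pdf _ _ _)%:E)%E.
  apply/eqP; rewrite -(eqrXn2 (n := 2))//; try by rewrite ltW.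
  by rewrite tE al0 expr0n mul0r add0r.
rewrite IH//.
transitivity (\int[mu]_u \int[mu]_y (g y * (normal_pdf (m (pa a)) (t (pa a)) u *
   normal_pdf (al a * u + be a) (sg a) y)%:E))%E.
  apply: eq_integral => u _; rewrite /g' -ge0_integralZr//.
  - by apply: eq_integral => y _; rewrite -muleA -EFinM [in RHS]mulrC.
  - apply: emeasurable_funM => //; apply/measurable_EFinP; exact: measurable_normal_pdf.
  - by move=> y _; rewrite mule_ge0// lee_fin normal_pdf_ge0.
  - by rewrite lee_fin normal_pdf_ge0.
apply: etrans (fubini_tonelli (m1 := mu) (m2 := mu)
  (fun p : R * R => g p.2 * (normal_pdf (m (pa a)) (t (pa a)) p.1 *
     normal_pdf (al a * p.1 + be a) (sg a) p.2)%:E)%E _ _) _ => /=.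
- apply: emeasurable_funM; first by apply: measurableT_comp => //; exact: measurable_snd.
  apply/measurable_EFinP; apply: measurable_funM.
    exact: measurable_normal_pdf_fun.
  apply: measurable_normal_pdf_fun => //.
  by apply: measurable_funD => //; exact: measurable_funM.
- by move=> p; rewrite mule_ge0// lee_fin mulr_ge0// normal_pdf_ge0.
apply: eq_integral => y _; rewrite ge0_integralZl//.
- by rewrite (integral_normal_conv _ _ _ _ _ _ (tE a))// -mE.
- apply/measurable_EFinP; apply: measurable_funM; first exact: measurable_normal_pdf.
  apply: measurable_normal_pdf_fun => //.
  by apply: measurable_funD => //; exact: measurable_funM.
- by move=> u _; rewrite lee_fin mulr_ge0// normal_pdf_ge0.
Qed.

End TreeGaussian.

(** * Depth, height and recursions along the path to the root *)

Section Depth.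
Context {V : finType} (root : V) (pa : V -> V).
Hypothesis tree : is_rooted_tree root pa.

Let depth_ex i : exists k, iter k pa i == root.
Proof. by case: tree => _ /(_ i)[k /eqP ki] _; exists k. Qed.

Definition depth i := ex_minn (depth_ex i).

Lemma iter_depth i : iter (depth i) pa i = root.
Proof. by rewrite /depth; case: ex_minnP => k /eqP. Qed.

Lemma depth_le i k : iter k pa i = root -> (depth i <= k)%N.
Proof. by move=> /eqP ki; rewrite /depth; case: ex_minnP => m _; apply. Qed.

Lemma depth_eq0 i : depth i = 0%N -> i = root.
Proof. by move=> d0; have := iter_depth i; rewrite d0. Qed.

Lemma depth_pa i : i != root -> depth i = (depth (pa i)).+1.
Proof.
move=> ir; apply/eqP; rewrite eqn_leq; apply/andP; split.
  by apply: depth_le; rewrite iterSr iter_depth.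
case e : (depth i) => [|k]; first by rewrite (depth_eq0 e) eqxx in ir.
by rewrite ltnS; apply: depth_le; rewrite -iterSr -e iter_depth.
Qed.

Lemma depth_iter i k : (k <= depth i)%N -> depth (iter k pa i) = (depth i - k)%N.
Proof.
elim: k => [|k IH] ki; first by rewrite subn0.
have := IH (ltnW ki); rewrite iterS => e.
have nr : iter k pa i != root.
  apply: contraTneq ki => /depth_le; rewrite -leqNgt//.
by move: e; rewrite depth_pa// => e; lia.
Qed.

(** The ancestors of [i] up to the root have pairwise different depths, hence are distinct nodes. *)
Lemma depth_lt i : (depth i < #|V|)%N.
Proof.
pose f (k : 'I_(depth i).+1) := iter k pa i.
have fi : injective f.
  move=> k l /(congr1 depth); rewrite /f !depth_iter -1?ltnS//.
  by move=> e; apply: val_inj => /=; have := ltn_ord k; have := ltn_ord l; lia.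
by have := leq_card f fi; rewrite card_ord.
Qed.

Lemma childrenP i j : reflect (j != root /\ pa j = i) (j \in children root pa i).
Proof. by rewrite inE; apply: (iffP andP) => -[jr /eqP]. Qed.

Lemma child_pa i : i != root -> i \in children root pa (pa i).
Proof. by move=> ir; apply/childrenP. Qed.

Lemma pa_not_leaf i : i != root -> is_leaf root pa (pa i) = false.
Proof.
move=> ir; apply/negbTE; rewrite /is_leaf -lt0n; apply/card_gt0P.
by exists i; exact: child_pa.
Qed.

Lemma depth_child i j : j \in children root pa i -> depth j = (depth i).+1.
Proof. by move=> /childrenP[jr <-]; exact: depth_pa. Qed.

(** The sum of fuel and depth is invariant on descending to a child, and without fuel the hypothesis
    contradicts [depth_lt]. *)
Lemma height_fuelS k i : (#|V| <= k + depth i)%N ->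
  height_fuel root pa k.+1 i = height_fuel root pa k i.
Proof.
elim: k i => [|k IH] i h; first by have := depth_lt i; lia.
rewrite [LHS]/= [RHS]/=; case: ifP => // _; congr S.
by apply: eq_bigr => j /depth_child dj; rewrite -IH// dj; lia.
Qed.

Lemma height_pa i : i != root -> (height root pa i < height root pa (pa i))%N.
Proof.
move=> ir; rewrite /height -(@height_fuelS #|V| (pa i)) ?leq_addr//=.
rewrite pa_not_leaf// ltnS; exact: leq_bigmax_cond (child_pa ir).
Qed.

Lemma leaf_exists : exists a, is_leaf root pa a.
Proof.
have [a _ amax] := @arg_maxnP V root xpredT depth isT.
exists a; rewrite /is_leaf cards_eq0; apply/eqP/setP => j; rewrite [RHS]inE.
apply/negbTE/negP => /depth_child dj; have := amax j isT.
by rewrite /geq/= dj ltnn.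
Qed.

Section PathRec.
Context {R : pzRingType} (al c : V -> R).
(** Solves [x i = al i * x (pa i) + c i] along the path to the root, where [al root = 0] stops the
    recursion; posterior means and variances are both of this form. *)
Fixpoint path_rec k i := if k is k'.+1 then al i * path_rec k' (pa i) + c i else 0.

Lemma path_recE i : al root = 0 ->
  path_rec #|V| i = al i * path_rec #|V| (pa i) + c i.
Proof.
move=> al0; rewrite -[RHS]/(path_rec #|V|.+1 i).
have : (depth i < #|V|)%N by exact: depth_lt.
elim: #|V| i => // k IH j jk.
have [->|jr] := eqVneq j root; first by rewrite /= al0 !mul0r.
rewrite -[LHS]/(al j * path_rec k (pa j) + c j) IH//.
by rewrite -ltnS -depth_pa.
Qed.

End PathRec.

End Depth.

(** * Precision statistics and their growth under a pull *)

Section Stat.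
Context {R : realType} {V : finType} (root : V) (pa : V -> V).
Variables (sigma0 : V -> R) (sigma : R).
Hypothesis tree : is_rooted_tree root pa.
Hypothesis sigma0_gt0 : forall i, 0 < sigma0 i.
Hypothesis sigma_gt0 : 0 < sigma.

Local Notation s2 i := (sigma0 i ^+ 2).
Local Notation stat := (stat_fuel root pa sigma0 sigma).
Local Notation S N i := (stat #|V| N i).

Let s2_gt0 i : 0 < s2 i. Proof. by rewrite exprn_gt0. Qed.

(** For [x > 0], [x / (1 + v * x)] is the inverse of [v + 1 / x]: the precision that a subtree with
    statistic [x] carries about the parent across a link of variance [v]. This form also gives 0 at
    [x = 0]. *)
Lemma shrink_le (v x y : R) : 0 < v -> 0 <= x -> x <= y ->
  x / (1 + v * x) <= y / (1 + v * y).
Proof.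
move=> v0 x0 xy; have y0 := le_trans x0 xy.
have h z : 0 <= z -> 0 < 1 + v * z by move=> ?; rewrite ltr_pwDl// mulr_ge0// ltW.
rewrite ler_pdivrMr ?h// mulrAC ler_pdivlMr ?h//.
by rewrite !mulrDr !mulr1 lerD// (mulrCA x) (mulrCA y) ler_pM2l// mulrC.
Qed.

Lemma shrink_ge0 (v x : R) : 0 < v -> 0 <= x -> 0 <= x / (1 + v * x).
Proof. by move=> v0 x0; rewrite divr_ge0// addr_ge0// mulr_ge0// ltW. Qed.

Lemma shrink_le_inv (v x : R) : 0 < v -> 0 <= x -> x / (1 + v * x) <= v^-1.
Proof.
move=> v0 x0; rewrite ler_pdivrMr; last by rewrite ltr_pwDl// mulr_ge0// ltW.
by rewrite mulrDr mulr1 mulKf ?gt_eqF// lerDr invr_ge0 ltW.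
Qed.

Lemma stat_ge0 k N i : 0 <= stat k N i.
Proof.
elim: k i => //= k IH i; case: ifP => _; first by rewrite divr_ge0// sqr_ge0.
by apply: sumr_ge0 => j _; exact: shrink_ge0.
Qed.

Lemma stat_mono k N N' i : (forall j, (N j <= N' j)%N) -> stat k N i <= stat k N' i.
Proof.
move=> NN'; elim: k i => //= k IH i; case: ifP => _.
  by rewrite ler_wpM2r ?invr_ge0 ?sqr_ge0// ler_nat.
by apply: ler_sum => j _; apply: shrink_le; rewrite ?stat_ge0.
Qed.

Lemma stat_fuelS k N i : (#|V| <= k + depth tree i)%N -> stat k.+1 N i = stat k N i.
Proof.
elim: k i => [|k IH] i h; first by have := depth_lt tree i; lia.
rewrite [LHS]/= [RHS]/=; case: ifP => // _.
apply: eq_bigr => j /(depth_child tree) dj.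
by rewrite -[in RHS]IH// dj; lia.
Qed.

Lemma statE N i : S N i =
  if is_leaf root pa i then (N i)%:R / sigma ^+ 2
  else \sum_(l in children root pa i) S N l / (1 + s2 l * S N l).
Proof. by rewrite -(@stat_fuelS #|V| N i) ?leq_addr. Qed.

Definition stat_bound (n : nat) i :=
  if is_leaf root pa i then s2 i * n%:R / sigma ^+ 2
  else s2 i * \sum_(j in children root pa i) (s2 j)^-1.

(** A child passes at most its prior precision to its parent, however often its descendants are
    pulled; hence [n] enters at action nodes only. *)
Lemma stat_le_bound n N i : (forall a, is_leaf root pa a -> (N a <= n)%N) ->
  s2 i * S N i <= stat_bound n i.
Proof.
move=> Nn; rewrite statE /stat_bound; case: ifP => [ia|_].
  rewrite -mulrA ler_pM2l// ler_wpM2r ?invr_ge0 ?sqr_ge0// ler_nat; exact: Nn.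
rewrite ler_pM2l//; apply: ler_sum => j _; apply: shrink_le_inv => //.
exact: stat_ge0.
Qed.

Lemma stat0 k i : stat k (fun=> 0%N) i = 0.
Proof.
elim: k i => //= k IH i; rewrite mul0r; case: ifP => // _.
by apply: big1 => j _; rewrite IH mul0r.
Qed.

(* With [w = ln (1 + r * z)], apply [1 + u <= expR u] at [u = L - w] and at
   [u = - w] and average with weights [r] and [1 - r]. *)
Lemma ln_scale (r z : R) : 0 <= r <= 1 -> 0 <= z -> r * ln (1 + z) <= ln (1 + r * z).
Proof.
move=> /andP[r0 r1] z0; set L := ln (1 + z); set w := ln (1 + r * z).
have z1 : 0 < 1 + z by rewrite ltr_pwDl.
have rz1 : 0 < 1 + r * z by rewrite ltr_pwDl// mulr_ge0.
have : r * expR (L - w) + (1 - r) * expR (- w) = 1.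
  rewrite expRD mulrA -mulrDl expRN lnK// lnK//.
  by rewrite (_ : r * (1 + z) + (1 - r) = 1 + r * z) ?divff ?gt_eqF//; ring.
have : r * (1 + (L - w)) + (1 - r) * (1 + - w) <=
       r * expR (L - w) + (1 - r) * expR (- w).
  by rewrite lerD// ler_wpM2l ?subr_ge0// expR_ge1Dx.
by move=> + e; rewrite e; lra.
Qed.

(** * Posterior variance against the gain of a single pull *)

Section Increment.
Variables (c : R) (N N' : V -> nat) (al t2 : V -> R).
Hypothesis NN' : forall j, (N j <= N' j)%N.
Hypothesis c1 : 1 <= c.
Hypothesis prec_le : forall i,
  hat_prec root pa sigma0 sigma N' i <= c * hat_prec root pa sigma0 sigma N i.
Hypothesis alE : forall i, i != root -> al i = (1 + s2 i * S N i)^-1.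
Hypothesis al0 : al root = 0.
Hypothesis t2E : forall i,
  t2 i = al i ^+ 2 * t2 (pa i) + s2 i / (1 + s2 i * S N i).

Local Notation hgt := (height root pa).

(** The slope for which [u <= kappa i * ln (1 + u / sigma ^+ 2)] holds on [0 <= u <= s2 i], with
    equality at both ends. *)
Definition kappa i := s2 i / ln (1 + s2 i / sigma ^+ 2).

Lemma ln_kappa_gt0 i : 0 < ln (1 + s2 i / sigma ^+ 2).
Proof. by rewrite ln_gt0// ltrDl divr_gt0// exprn_gt0. Qed.

Lemma kappa_gt0 i : 0 < kappa i.
Proof. by rewrite divr_gt0// ln_kappa_gt0. Qed.

Lemma stat_1p_gt0 M i : 0 < 1 + s2 i * S M i.
Proof. by rewrite ltr_pwDl// mulr_ge0 ?stat_ge0// ltW. Qed.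

(** The share of node [i] in the decrease of the potential when the counts pass from [N] to [N']. *)
Definition gain i :=
  c ^+ hgt i * (kappa i * (ln (1 + s2 i * S N' i) - ln (1 + s2 i * S N i))).

Let c_gt0 : 0 < c. Proof. exact: lt_le_trans c1. Qed.
Let ch_gt0 k : 0 < c ^+ k. Proof. by rewrite exprn_gt0. Qed.

Lemma gain_ge0 i : 0 <= gain i.
Proof.
rewrite mulr_ge0 ?exprn_ge0 ?(ltW c_gt0)// mulr_ge0 ?(ltW (kappa_gt0 _))//.
rewrite subr_ge0 ler_ln ?posrE ?stat_1p_gt0//.
by rewrite lerD2l ler_pM2l// stat_mono.
Qed.

(** Concavity of the logarithm is used twice. With weight [u / s2 i] it bounds [u], which is [x]
    times the conditional variance, by [kappa i * ln (1 + u / sigma ^+ 2)]. With weight [c ^- hgt i]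
    it moves that weight inside the logarithm, where the assumed increase of the statistic bounds
    the argument by the ratio of the two precisions. *)
Lemma le_gain i x : 0 <= x <= 1 ->
  (c ^+ hgt i)^-1 * x / sigma ^+ 2 <= S N' i - S N i ->
  x * (s2 i / (1 + s2 i * S N i)) <= gain i.
Proof.
move=> /andP[x0 x1] dS.
have P0 := stat_1p_gt0 N i; have P0' := stat_1p_gt0 N' i.
have ss0 : 0 < sigma ^+ 2 by rewrite exprn_gt0.
set sh := s2 i / _; have sh0 : 0 < sh by rewrite divr_gt0.
set u := x * sh; have u0 : 0 <= u by rewrite mulr_ge0// ltW.
have us : u <= s2 i.
  apply: (@le_trans _ _ sh); first by rewrite ler_piMl// ltW.
  rewrite /sh ler_pdivrMr// ler_peMr ?(ltW (s2_gt0 i))// lerDl.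
  by rewrite mulr_ge0 ?stat_ge0// ltW.
set rho := (c ^+ hgt i)^-1 in dS *.
have rho01 : 0 <= rho <= 1.
  by rewrite invr_ge0 ltW//= invf_le1// exprn_ege1.
set z := u / sigma ^+ 2; have z0 : 0 <= z by rewrite divr_ge0// ltW.
have h1 : u <= kappa i * ln (1 + z).
  have lam01 : 0 <= u / s2 i <= 1.
    by rewrite divr_ge0 ?(ltW (s2_gt0 i))//= ler_pdivrMr// mul1r.
  have v0 : 0 <= s2 i / sigma ^+ 2 by rewrite divr_ge0 ?ltW.
  have := ln_scale lam01 v0; rewrite mulrA divfK ?gt_eqF// -/z => h.
  rewrite /kappa mulrAC ler_pdivlMr ?ln_kappa_gt0//.
  by rewrite -[u](divfK (lt0r_neq0 (s2_gt0 i))) mulrAC mulrC ler_pM2l.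
have h2 : rho * ln (1 + z) <= ln (1 + s2 i * S N' i) - ln (1 + s2 i * S N i).
  apply: le_trans (ln_scale rho01 z0) _; rewrite -ln_div ?posrE//.
  rewrite ler_ln ?posrE ?divr_gt0//; last first.
    by case/andP: rho01 => r0 _; rewrite ltr_pwDl// mulr_ge0.
  have -> : (1 + s2 i * S N' i) / (1 + s2 i * S N i) = 1 + sh * (S N' i - S N i).
    by rewrite /sh; field; rewrite gt_eqF.
  rewrite lerD2l (le_trans _ (ler_wpM2l (ltW sh0) dS))// /z /u.
  by rewrite le_eqVlt; apply/orP; left; apply/eqP; ring.
apply: (le_trans h1).
have -> : kappa i * ln (1 + z) = c ^+ hgt i * (kappa i * (rho * ln (1 + z))).
  by rewrite /rho; field; rewrite gt_eqF.
by rewrite ler_pM2l// ler_pM2l// kappa_gt0.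
Qed.

(** Shrinkage turns an increment [d] of the child's statistic into [d] divided by
    [(1 + s2 i * S N' i) * (1 + s2 i * S N i)]. The precision hypothesis, multiplied by [s2 i],
    bounds the first factor by [c] times the second: this is the one factor [c] lost. The other
    children contribute nonnegative terms. *)
Lemma stat_step i : i != root ->
  c^-1 * (al i ^+ 2 * (S N' i - S N i)) <= S N' (pa i) - S N (pa i).
Proof.
move=> ir; rewrite (statE N' (pa i)) (statE N (pa i)) pa_not_leaf// -sumrB.
rewrite (bigD1 i) ?child_pa//=.
have P0 := stat_1p_gt0 N i; have P0' := stat_1p_gt0 N' i.
have dS : 0 <= S N' i - S N i by rewrite subr_ge0 stat_mono.
have h : c^-1 * (al i ^+ 2 * (S N' i - S N i)) <=
  S N' i / (1 + s2 i * S N' i) - S N i / (1 + s2 i * S N i).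
  have -> : S N' i / (1 + s2 i * S N' i) - S N i / (1 + s2 i * S N i) =
    (1 + s2 i * S N' i)^-1 * ((1 + s2 i * S N i)^-1 * (S N' i - S N i)).
    by field; rewrite !gt_eqF.
  rewrite alE// expr2 !mulrA -!(mulrA _ _ (S N' i - S N i)).
  apply: ler_wpM2r; first by rewrite mulr_ge0// invr_ge0 ltW.
  rewrite -invfM lef_pV2 ?posrE ?mulr_gt0//.
  have := prec_le i; rewrite /hat_prec -(ler_pM2l (s2_gt0 i)) mulrCA !mulrDr.
  by rewrite mulfV ?gt_eqF.
apply: (le_trans h); rewrite lerDl; apply: sumr_ge0 => j _.
by rewrite subr_ge0 shrink_le ?stat_ge0// stat_mono.
Qed.

(* [x] is the squared product of the shrinkage factors from the pulled action up
   to [i]; summing over depths avoids indexing the nodes of the path. *)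
Lemma le_gain_path d i x : depth tree i = d -> 0 <= x <= 1 ->
  (c ^+ hgt i)^-1 * x / sigma ^+ 2 <= S N' i - S N i ->
  x * t2 i <= \sum_(j | (depth tree j <= d)%N) gain j.
Proof.
elim: d i x => [|d IH] i x di x01 dS; rewrite t2E mulrDr.
  rewrite (depth_eq0 di) in dS *; rewrite al0 expr0n mul0r mulr0 add0r.
  rewrite (le_trans (le_gain x01 dS))// (bigD1 root)/=; last first.
    by rewrite -di (depth_eq0 di).
  by rewrite lerDl sumr_ge0// => j _; exact: gain_ge0.
have ir : i != root.
  apply: contra_eq_neq di => ->; suff -> : depth tree root = 0%N by [].
  by apply/eqP; rewrite -leqn0; exact: depth_le.
have dpa : depth tree (pa i) = d by move: di; rewrite (depth_pa tree ir) => -[].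
have P0 := stat_1p_gt0 N i.
have al01 : 0 <= al i ^+ 2 <= 1.
  rewrite sqr_ge0 exprn_ile1// alE// ?invr_ge0 ?(ltW P0)// invf_le1// lerDl.
  by rewrite mulr_ge0 ?stat_ge0// ltW.
case/andP: (al01) => a0 a1; case/andP: (x01) => x0 x1.
have ss0 : 0 < sigma ^+ 2 by rewrite exprn_gt0.
rewrite mulrA (bigD1 i)/= ?di// addrC lerD//; last exact: le_gain.
apply: (@le_trans _ _ (\sum_(j | (depth tree j <= d)%N) gain j)); last first.
  rewrite [leRHS](bigID (fun j => (depth tree j <= d)%N))/=.
  rewrite [X in _ <= X + _](eq_bigl (fun j => (depth tree j <= d)%N)); last first.
    move=> j; apply/andP/idP => [[]//|jd]; split=> //; rewrite leqW//=.
    by apply: contraTneq jd => ->; rewrite di ltnn.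
  by rewrite lerDl sumr_ge0// => j _; exact: gain_ge0.
apply: (IH _ _ dpa); first by rewrite mulr_ge0//= mulr_ile1.
apply: le_trans (stat_step ir).
have -> : (c ^+ hgt (pa i))^-1 * (x * al i ^+ 2) / sigma ^+ 2 =
    (al i ^+ 2 * (x / sigma ^+ 2)) * (c ^+ hgt (pa i))^-1 by ring.
(* The height grows by at least one from [i] to its parent; since [1 <= c], this growth pays for the
   factor lost in [stat_step]. *)
apply: (@le_trans _ _ (al i ^+ 2 * (x / sigma ^+ 2) * (c ^+ (hgt i).+1)^-1)).
  apply: ler_wpM2l; first by rewrite mulr_ge0 ?divr_ge0 ?(ltW ss0).
  rewrite lef_pV2 ?posrE//; exact: ler_weXn2l (height_pa tree ir).
have -> : al i ^+ 2 * (x / sigma ^+ 2) * (c ^+ (hgt i).+1)^-1 =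
    c^-1 * (al i ^+ 2 * ((c ^+ hgt i)^-1 * x / sigma ^+ 2)).
  by rewrite (exprS c) (invfM c); ring.
by rewrite ler_wpM2l ?invr_ge0 ?(ltW c_gt0)// ler_wpM2l.
Qed.

(** The pull raises the statistic of [a] itself by exactly [1 / sigma ^+ 2], so the path bound
    starts with [x = 1]. *)
Lemma t2_le_gain a : is_leaf root pa a -> N' a = (N a).+1 ->
  t2 a <= \sum_j gain j.
Proof.
move=> la Na; rewrite -[t2 a]mul1r.
apply: le_trans (le_gain_path (erefl _) _ _) _; first by rewrite ler01 lexx.
- rewrite !statE la Na -mulrBl mulr1 ler_pM2r ?invr_gt0 ?exprn_gt0//.
  by rewrite -natrB// subSnn invf_le1// exprn_ege1.
- rewrite [leRHS](bigID (fun j => (depth tree j <= depth tree a)%N))/= lerDl.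
  by rewrite sumr_ge0// => j _; exact: gain_ge0.
Qed.

End Increment.

End Stat.

(** * Posterior as a linear Gaussian network *)

Section Posterior.
Context {R : realType} {V : finType} (root : V) (pa : V -> V).
Variables (mu1 : R) (sigma0 : V -> R) (sigma : R).
Hypothesis tree : is_rooted_tree root pa.
Hypothesis sigma0_gt0 : forall i, 0 < sigma0 i.
Hypothesis sigma_gt0 : 0 < sigma.

Local Notation s2 i := (sigma0 i ^+ 2).
Local Notation S N i := (stat_fuel root pa sigma0 sigma #|V| N i).
Local Notation leaf := (is_leaf root pa).
Local Notation hist := (seq (V * R)).

Let s2_gt0 i : 0 < s2 i. Proof. by rewrite exprn_gt0. Qed.

(* The conditional posterior variance of node [i] is [shr N i * sigma0 i ^+ 2], and
   [shr N i] is the weight of the parent's value in the conditional posterior mean. *)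
Definition shr (N : V -> nat) i : R := (1 + s2 i * S N i)^-1.
Definition post_al N i : R := if i == root then 0 else shr N i.
Definition post_sg N i : R := Num.sqrt (shr N i * s2 i).
(** Law of total variance down the path: the parent's posterior variance times the squared weight,
    plus the conditional variance. *)
Definition post_t2 N : V -> R :=
  path_rec pa (fun i => post_al N i ^+ 2) (fun i => shr N i * s2 i) #|V|.
Definition post_t N i : R := Num.sqrt (post_t2 N i).

Lemma shr_gt0 N i : 0 < shr N i.
Proof. by rewrite invr_gt0 ltr_pwDl// mulr_ge0 ?stat_ge0// ltW. Qed.

Lemma shr_le1 N i : shr N i <= 1.
Proof.
rewrite invf_le1 ?lerDl ?mulr_ge0 ?stat_ge0// ?ltW//.
by rewrite ltr_pwDl// mulr_ge0 ?stat_ge0// ltW.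
Qed.

Lemma post_sg_gt0 N i : 0 < post_sg N i.
Proof. by rewrite sqrtr_gt0 mulr_gt0// shr_gt0. Qed.

Lemma sqr_post_sg N i : post_sg N i ^+ 2 = shr N i * s2 i.
Proof. by rewrite sqr_sqrtr// mulr_ge0// ltW// shr_gt0. Qed.

Lemma post_al_root N : post_al N root = 0.
Proof. by rewrite /post_al eqxx. Qed.

Lemma post_t2E N i :
  post_t2 N i = post_al N i ^+ 2 * post_t2 N (pa i) + shr N i * s2 i.
Proof. by rewrite /post_t2 (path_recE tree)// post_al_root expr0n. Qed.

Lemma path_rec_ge0 (al c : V -> R) k i : (forall i, 0 <= al i) ->
  (forall i, 0 <= c i) -> 0 <= path_rec pa al c k i.
Proof.
by move=> al0 c0; elim: k i => //= k IH i; rewrite addr_ge0// mulr_ge0.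
Qed.

Lemma post_t2_gt0 N i : 0 < post_t2 N i.
Proof.
rewrite post_t2E ltr_wpDl// ?mulr_gt0 ?shr_gt0//.
rewrite mulr_ge0 ?sqr_ge0// path_rec_ge0// => j; first exact: sqr_ge0.
by rewrite mulr_ge0// ltW// shr_gt0.
Qed.

Lemma post_t_gt0 N i : 0 < post_t N i.
Proof. by rewrite sqrtr_gt0 post_t2_gt0. Qed.

Lemma sqr_post_t N i : post_t N i ^+ 2 = post_t2 N i.
Proof. by rewrite sqr_sqrtr// ltW// post_t2_gt0. Qed.

Lemma post_tE N i :
  post_t N i ^+ 2 = post_al N i ^+ 2 * post_t N (pa i) ^+ 2 + post_sg N i ^+ 2.
Proof. by rewrite !sqr_post_t sqr_post_sg post_t2E. Qed.

Lemma on_path_root j : on_path pa root j = (j == root).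
Proof.
case: tree => paroot _ _; have it k : iter k pa root = root by elim: k => //= k ->.
apply/existsP/eqP => [[k]|->]; first by rewrite it => /eqP.
have V0 : (0 < #|V|)%N by apply/card_gt0P; exists root.
by exists (Ordinal V0); rewrite it.
Qed.

Lemma on_path_pa i j : i != root -> on_path pa (pa i) j -> on_path pa i j.
Proof.
case: (tree) => paroot _ _ ir /existsP[[k /= kV] /eqP kj].
have itr l : iter l pa root = root by elim: l => //= l ->.
have [kd|dk] := ltnP k (depth tree (pa i)).
  have lt : (k.+1 < #|V|)%N.
    by apply: leq_ltn_trans (depth_lt tree i); rewrite (depth_pa tree ir) ltnW// ltnS.
  by apply/existsP; exists (Ordinal lt); rewrite /= -iterS iterSr kj.
have -> : j = root by rewrite -kj -(subnK dk) iterD iter_depth itr.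
apply/existsP; exists (Ordinal (depth_lt tree i)) => /=.
by rewrite iter_depth.
Qed.

Lemma on_path_self i : on_path pa i i.
Proof.
have V0 : (0 < #|V|)%N by apply/card_gt0P; exists root.
by apply/existsP; exists (Ordinal V0).
Qed.

Lemma on_path_depth i j : on_path pa i j -> (depth tree j <= depth tree i)%N.
Proof.
move=> /existsP[[k /= _] /eqP <-]; elim: k => //= k IH.
apply: leq_trans IH; case: (eqVneq (iter k pa i) root) => [->|ir].
  by have [-> _ _] := tree.
by rewrite (depth_pa tree ir) leqnSn.
Qed.

(** All shrinkage factors are at most 1, so the unrolled recursion is dominated term by term by the
    prior variances on the path. *)
Lemma post_t2_le N i : post_t2 N i <= \sum_(j | on_path pa i j) s2 j.
Proof.
move: {2}(depth tree i) (erefl (depth tree i)) => d; elim: d i => [|d IH] i di.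
  rewrite (depth_eq0 di) post_t2E post_al_root expr0n mul0r add0r.
  rewrite (bigD1 root) ?on_path_root//= big1 ?addr0; last first.
    by move=> j; rewrite on_path_root => /andP[->].
  by rewrite ler_piMl ?(ltW (s2_gt0 _))// shr_le1.
have ir : i != root.
  apply: contra_eq_neq di => ->; suff -> : depth tree root = 0%N by [].
  by apply/eqP; rewrite -leqn0; exact: depth_le.
have dpa : depth tree (pa i) = d by move: di; rewrite (depth_pa tree ir) => -[].
rewrite (bigD1 i) ?on_path_self//= addrC post_t2E lerD//; last first.
  by rewrite ler_piMl ?(ltW (s2_gt0 _))// shr_le1.
apply: (@le_trans _ _ (post_t2 N (pa i))).
  rewrite ler_piMl ?(ltW (post_t2_gt0 _ _))// exprn_ile1// /post_al (negbTE ir).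
    by rewrite ltW// shr_gt0.
  exact: shr_le1.
apply: le_trans (IH _ dpa) _.
rewrite [leRHS](bigID (on_path pa (pa i)))/= [X in _ <= X + _](_ : _ =
    \sum_(j | on_path pa (pa i) j) s2 j).
  by rewrite lerDl sumr_ge0// => j _; rewrite ltW.
apply: eq_bigl => j; apply/andP/idP => [[]//|pj]; split=> //.
rewrite on_path_pa//=; apply: contraTneq pj => ->.
by apply: contraL (leqnn (depth tree i)) => /on_path_depth; rewrite dpa di ltnn.
Qed.

Lemma post_t_le_max N a : leaf a -> post_t N a <= sigma_max root pa sigma0.
Proof.
move=> la; apply: (@le_trans _ _ (Num.sqrt (\sum_(j | on_path pa a j) s2 j))).
  by rewrite ler_sqrt ?post_t2_le// sumr_ge0// => j _; rewrite ltW.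
rewrite /sigma_max.
apply: (le_bigmax_cond _ (fun a => Num.sqrt (\sum_(j | on_path pa a j) s2 j))).
by rewrite inE.
Qed.

Definition pulls (h : hist) (b : V) : nat := count (fun p => p.1 == b) h.
Definition reward (h : hist) (b : V) : R := \sum_(p <- h | p.1 == b) p.2.

(** The squared rewards go into [K]; what remains depends on the history through pull counts and
    reward sums only. *)
Lemma likelihood_quad (h : hist) : all (fun p => leaf p.1) h ->
  exists2 K, 0 < K & forall th, likelihood sigma h th = K *
   expR (\sum_(i | leaf i) (- ((pulls h i)%:R / sigma ^+ 2) * th i ^+ 2 / 2 +
                            reward h i / sigma ^+ 2 * th i)).
Proof.
elim: h => [_|[a y] h IH /= /andP[la /IH[K K0 KE]]].
  exists 1 => // th; rewrite /likelihood big_nil big1 ?expR0 ?mulr1// => i _.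
  by rewrite /reward big_nil /= !mul0r oppr0 !mul0r addr0.
exists (normal_peak sigma * expR (- y ^+ 2 / (sigma ^+ 2 *+ 2)) * K).
  by rewrite !mulr_gt0 ?expR_gt0// normal_peak_gt0// gt_eqF.
move=> th; rewrite /likelihood big_cons -[X in _ * X]/(likelihood sigma h th).
rewrite KE normal_pdfE_expR//= -!mulrA; congr (_ * _).
rewrite [RHS]mulrCA [LHS]mulrCA; congr (_ * _); rewrite -!expRD; congr expR.
rewrite (bigD1 a)//= [in RHS](bigD1 a)//= !addrA; congr (_ + _).
  rewrite /pulls /reward/= big_cons/= eqxx natrD/=.
  by field; rewrite gt_eqF.
apply: eq_bigr => i /andP[_ ia]; rewrite /pulls /reward/= big_cons/=.
by rewrite eq_sym (negbTE ia).
Qed.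

Section LinStat.
Variable h : hist.
Local Notation N := (pulls h).

(* The coefficient of [th i] in the exponent once the descendants of [i] have been
   integrated out; the coefficient of [th i ^+ 2] is [- stat_fuel #|V| N i / 2]. *)
Fixpoint lin_fuel k i : R := if k is k'.+1 then
    if leaf i then reward h i / sigma ^+ 2
    else \sum_(l in children root pa i) shr N l * lin_fuel k' l
  else 0.
Local Notation b i := (lin_fuel #|V| i).

Lemma lin_fuelS k i : (#|V| <= k + depth tree i)%N -> lin_fuel k.+1 i = lin_fuel k i.
Proof.
elim: k i => [|k IH] i hk; first by have := depth_lt tree i; lia.
rewrite [LHS]/= [RHS]/=; case: ifP => // _.
apply: eq_bigr => j /(depth_child tree) dj.
by rewrite -[in RHS]IH// dj; lia.
Qed.

Lemma linE i : b i = if leaf i then reward h i / sigma ^+ 2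
    else \sum_(l in children root pa i) shr N l * b l.
Proof. by rewrite -(@lin_fuelS #|V| i) ?leq_addr. Qed.

Definition post_be i : R :=
  (if i == root then shr N i * mu1 else 0) + shr N i * s2 i * b i.

Lemma sum_children (F : V -> V -> R) :
  \sum_(i | ~~ leaf i) \sum_(l in children root pa i) F l i =
  \sum_(l | l != root) F l (pa l).
Proof.
rewrite [RHS](partition_big pa (fun i => ~~ leaf i))/=; last first.
  by move=> l lr; rewrite pa_not_leaf.
apply: eq_bigr => i _; apply: eq_big => [l|l]; first by rewrite inE.
by move=> /childrenP[_ ->].
Qed.

(* Completing the square at node [i] leaves a quadratic in the parent's value;
   [statE] and [linE] say that the parent's own quadratic is the sum of those
   left by its children, so the sum over the tree telescopes. *)
Lemma posterior_factor : all (fun p => leaf p.1) h ->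
  exists2 Z, 0 < Z & forall th s, perm_eq s (enum V) ->
    prior_pdf root pa mu1 sigma0 th * likelihood sigma h th =
    Z * tg_pdf pa (post_al N) post_be (post_sg N) s th.
Proof.
move=> /likelihood_quad[K K0 KE].
(* [u] gives the root a fictitious parent of value [mu1]. [C] collects the constants left by the
   completed squares and the quadratic in [mu1] that the root leaves behind. *)
pose u (th : V -> R) i := if i == root then mu1 else th (pa i).
pose C := \sum_i (shr N i * s2 i * b i ^+ 2 / 2) +
  (- (shr N root * S N root) * mu1 ^+ 2 / 2 + shr N root * b root * mu1).
exists (K * expR C * \prod_i (normal_peak (sigma0 i) / normal_peak (post_sg N i))).
  rewrite !mulr_gt0 ?expR_gt0// prodr_gt0// => i _.
  by rewrite divr_gt0// normal_peak_gt0// gt_eqF// post_sg_gt0.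
move=> th s ps.
have -> : prior_pdf root pa mu1 sigma0 th =
    \prod_i normal_peak (sigma0 i) *
    expR (\sum_i (- (th i - u th i) ^+ 2 / (s2 i *+ 2))).
  rewrite expR_sum -big_split/=; apply: eq_bigr => i _.
  by rewrite /u; case: ifP => _; rewrite normal_pdfE_expR.
have -> : tg_pdf pa (post_al N) post_be (post_sg N) s th =
    \prod_i normal_peak (post_sg N i) *
    expR (\sum_i (- (th i - shr N i * u th i - shr N i * s2 i * b i) ^+ 2 /
        ((shr N i * s2 i) *+ 2))).
  rewrite /tg_pdf (perm_big _ ps)/= big_enum/= expR_sum -big_split/=.
  apply: eq_bigr => i _; rewrite /tg_node normal_pdfE_expR ?post_sg_gt0//.
  rewrite sqr_post_sg /post_al /post_be /u; case: eqVneq => [->|_].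
    by rewrite mul0r add0r opprD addrA.
  by rewrite add0r opprD addrA.
have B0 : \prod_i normal_peak (post_sg N i) != 0.
  by apply/prodf_neq0 => i _; rewrite gt_eqF// normal_peak_gt0// gt_eqF// post_sg_gt0.
rewrite KE prodf_div; move: (\prod_i normal_peak (post_sg N i)) B0 => B B0.
move: (\prod_i normal_peak (sigma0 i)) => A.
rewrite [LHS]mulrACA -expRD.
set e1 := (X in A * K * expR X); set e3 := (X in _ = _ * (B * expR X)).
suff -> : e1 = e3 + C by rewrite expRD; field.
rewrite /e1 /e3 {e1 e3}.
have quadE : \sum_i (- S N i * th i ^+ 2 / 2 + b i * th i) =
  \sum_(i | leaf i) (- ((N i)%:R / sigma ^+ 2) * th i ^+ 2 / 2 +
                            reward h i / sigma ^+ 2 * th i) +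
  \sum_(l | l != root) (- (shr N l * S N l) * th (pa l) ^+ 2 / 2 +
      shr N l * b l * th (pa l)).
  rewrite -(sum_children (fun l i => - (shr N l * S N l) * th i ^+ 2 / 2 +
      shr N l * b l * th i)) (bigID leaf)/=; congr (_ + _).
    by apply: eq_bigr => i li; rewrite (statE sigma0 tree sigma_gt0) linE li.
  apply: eq_bigr => i /negbTE li; rewrite (statE sigma0 tree sigma_gt0) linE li.
  rewrite big_split/= -!mulr_suml sumrN.
  by congr (- _ * _ / _ + _); apply: eq_bigr => l _; rewrite mulrC.
have uE : \sum_i (- (shr N i * S N i) * u th i ^+ 2 / 2 + shr N i * b i * u th i) =
  (- (shr N root * S N root) * mu1 ^+ 2 / 2 + shr N root * b root * mu1) +
  \sum_(l | l != root) (- (shr N l * S N l) * th (pa l) ^+ 2 / 2 +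
      shr N l * b l * th (pa l)).
  rewrite (bigD1 root)//= /u eqxx; congr (_ + _).
  by apply: eq_bigr => i /negbTE ->.
have node : \sum_i (- (th i - u th i) ^+ 2 / (s2 i *+ 2)) +
  \sum_i (- S N i * th i ^+ 2 / 2 + b i * th i) =
  \sum_i (- (th i - shr N i * u th i - shr N i * s2 i * b i) ^+ 2 /
        ((shr N i * s2 i) *+ 2)) +
  \sum_i (- (shr N i * S N i) * u th i ^+ 2 / 2 + shr N i * b i * u th i) +
  \sum_i (shr N i * s2 i * b i ^+ 2 / 2).
  rewrite -!big_split/=; apply: eq_bigr => i _; rewrite /shr.
  have := stat_1p_gt0 root pa sigma sigma0_gt0 N i; have := s2_gt0 i.
  move: (S N i) (b i) (u th i) (th i) => Si bi ui xi.
  rewrite exprn_gt0// => ? ?; field.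
  by rewrite !gt_eqF.
rewrite quadE uE in node; rewrite /C; lra.
Qed.

End LinStat.

End Posterior.

(** * The maximizing action and its measurability *)

Section Best.
Context {R : realType} {V : finType} (root : V) (pa : V -> V).
Local Notation state := (V -> R).
Local Notation best := (@best R V root pa).

Lemma bestP (th : state) : is_rooted_tree root pa ->
  is_leaf root pa (best th) /\
  forall a, is_leaf root pa a -> th a <= th (best th).
Proof.
move=> tree; rewrite /best; case: pickP => [a0 a0l|no]; last first.
  by have [a la] := leaf_exists tree; have := no a; rewrite inE la.
case: arg_maxP => // i il imax; split; first by rewrite inE in il.
by move=> a la; apply: imax; rewrite inE.
Qed.

(* The maximizer depends on [th] only through finitely many comparisons. *)
Lemma best_factor : exists B : {ffun V * V -> bool} -> V,
  forall th : state, best th = B [ffun p => th p.1 <= th p.2].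
Proof.
rewrite /best; case: pickP => [a0 _|_]; last by exists (fun=> root).
exists (fun M => odflt a0 [pick i | (i \in leaves root pa) &&
   [forall j, (j \in leaves root pa) ==> M (j, i)]]) => th.
rewrite /Order.arg_max /extremum; congr odflt; apply: eq_pick => i /=.
by congr (_ && _); apply: eq_forallb => j; rewrite ffunE.
Qed.

Lemma measurable_natr_bool d (T : measurableType d) (f : T -> bool) :
  measurable_fun setT f -> measurable_fun setT (fun t => (f t)%:R : R).
Proof.
by move=> mf; apply: (measurableT_comp (f := fun b : bool => b%:R : R)).
Qed.

Lemma measurable_best_eq d (T : measurableType d) (phi : T -> state) a :
  coord_meas phi -> measurable_fun setT (fun t => (best (phi t) == a)%:R : R).
Proof.
move=> mphi; have [B BE] := best_factor.
(* The sum runs over all comparison tables [M]; the product is the indicator that [M] is the actual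
   table, so exactly one term survives. *)
have -> : (fun t => (best (phi t) == a)%:R : R) = (fun t =>
  \sum_(M <- enum {: {ffun V * V -> bool}}) (B M == a)%:R *
    \prod_(p <- enum {: V * V}) ((phi t p.1 <= phi t p.2) == M p)%:R).
  apply/funext => t; rewrite BE [RHS]big_enum/=.
  rewrite [RHS](bigD1 [ffun p => phi t p.1 <= phi t p.2])//= [X in _ + X]big1 ?addr0.
    by rewrite big_enum/= big1 ?mulr1// => p _; rewrite ffunE eqxx.
  move=> M /eqP MN; suff [p pN] : exists p, (phi t p.1 <= phi t p.2) != M p.
    rewrite big_enum/= (bigD1 p)//= (negbTE pN) mul0r mulr0//.
  apply: contrapT => no; apply: MN; apply/ffunP => p; rewrite ffunE.
  by apply/eqP; rewrite eq_sym; apply/negPn/negP => pN; apply: no; exists p.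
apply: measurable_sum => M; apply: measurable_funM => //.
apply: measurable_prod_seq => p.
apply: measurable_natr_bool.
apply: (measurableT_comp (f := fun b : bool => b == M p)) => //.
by apply: measurable_fun_ler; exact: mphi.
Qed.

Lemma best_sum (F : V -> R) (th : state) :
  F (best th) = \sum_(a <- enum V) (best th == a)%:R * F a.
Proof.
rewrite big_enum/= (bigD1 (best th))//= eqxx mul1r big1 ?addr0// => a aN.
by rewrite eq_sym (negbTE aN) mul0r.
Qed.

Lemma measurable_best d (T : measurableType d) (phi : T -> state)
    (F : V -> T -> R) : coord_meas phi ->
  (forall a, measurable_fun setT (F a)) ->
  measurable_fun setT (fun t => F (best (phi t)) t).
Proof.
move=> mphi mF; under eq_fun do rewrite (best_sum (F^~ _)).
apply: measurable_sum => a; apply: measurable_funM => //.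
exact: measurable_best_eq.
Qed.

End Best.

(** * Measurable families of histories *)

Section History.
Context {R : realType} {V : finType}.
Local Notation hist := (seq (V * R)).

(** The action sequence is the same throughout the family and only the rewards vary. An action that
    depends on the parameter is first resolved into its finitely many values by
    [measurable_best]. *)
Inductive hmeas d (T : measurableType d) : (T -> hist) -> Prop :=
| hmeas_nil : hmeas (fun _ : T => [::])
| hmeas_rcons H a (y : T -> R) : hmeas H -> measurable_fun setT y ->
    hmeas (fun t => rcons (H t) (a, y t)).

Lemma hmeas_comp d (T : measurableType d) d' (T' : measurableType d')
    (u : T' -> T) (H : T -> hist) : measurable_fun setT u -> hmeas H ->
  hmeas (fun t => H (u t)).
Proof.
move=> mu; elim=> [|H' a y _ IH my]; first exact: hmeas_nil.
by apply: hmeas_rcons => //; exact: measurableT_comp.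
Qed.

Lemma hmeas_cst d (T : measurableType d) (h : hist) : hmeas (fun _ : T => h).
Proof.
elim/last_ind: h => [|h [a y] IH]; first exact: hmeas_nil.
by apply: (@hmeas_rcons _ _ (fun=> h) a (fun=> y)).
Qed.

End History.

(** * Measurability of the regret *)

Section RegretMeasurable.
Context {R : realType} {V : finType} (root : V) (pa : V -> V).
Variables (mu1 : R) (sigma0 : V -> R) (sigma : R).
Hypothesis tree : is_rooted_tree root pa.
Hypothesis sigma0_gt0 : forall i, 0 < sigma0 i.
Hypothesis sigma_gt0 : 0 < sigma.
Local Notation mu := (@lebesgue_measure R).
Local Notation state := (V -> R).
Local Notation hist := (seq (V * R)).
Local Notation best := (@best R V root pa).
Local Notation prior := (prior_pdf root pa mu1 sigma0).
Local Notation lik := (likelihood sigma).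
Local Notation rtg := (regret_to_go root pa mu1 sigma0 sigma).

Lemma prior_ge0 th : 0 <= prior th.
Proof.
by apply: prodr_ge0 => i _; case: ifP => _; exact: normal_pdf_ge0.
Qed.

Lemma lik_ge0 (h : hist) th : 0 <= lik h th.
Proof. by apply: prodr_ge0 => p _; exact: normal_pdf_ge0. Qed.

Lemma lik_rcons (h : hist) a y th :
  lik (rcons h (a, y)) th = lik h th * normal_pdf (th a) sigma y.
Proof. by rewrite /likelihood -cats1 big_cat big_seq1. Qed.

Lemma measurable_prior d (T : measurableType d) (phi : T -> state) :
  coord_meas phi -> measurable_fun setT (fun t => prior (phi t)).
Proof.
move=> mphi.
apply: measurable_prod_seq => i; case: (i == root).
  by apply: measurable_normal_pdf_fun => //; exact: mphi.
by apply: measurable_normal_pdf_fun => //; exact: mphi.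
Qed.

Lemma measurable_lik d (T : measurableType d) (H : T -> hist) (phi : T -> state) :
  hmeas H -> coord_meas phi -> measurable_fun setT (fun t => lik (H t) (phi t)).
Proof.
move=> mH mphi; elim: mH => [|H' a y _ IH my].
  by rewrite /likelihood; under eq_fun do rewrite big_nil; exact: measurable_cst.
under eq_fun do rewrite lik_rcons; apply: measurable_funM => //.
by apply: measurable_normal_pdf_fun => //; exact: mphi.
Qed.

Lemma gap_ge0 (th th' : state) : 0 <= th (best th) - th (best th').
Proof.
rewrite subr_ge0; have [_] := bestP th tree; apply.
by have [] := bestP th' tree.
Qed.

Lemma int_V_ge0 (f : state -> R) : (forall x, 0 <= f x) -> 0 <= int_V f.
Proof. exact: int_seq_ge0. Qed.

Lemma rtg_ge0 k th h : 0 <= rtg k th h.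
Proof.
elim: k th h => [//|k IH] th h /=; rewrite /post_expect divr_ge0//.
  apply: int_V_ge0 => x; rewrite mulr_ge0 ?lik_ge0// mulr_ge0 ?prior_ge0//.
  rewrite addr_ge0 ?gap_ge0//; apply: Rintegral_ge0 => y _.
  by rewrite mulr_ge0// normal_pdf_ge0.
by apply: int_V_ge0 => x; rewrite mulr_ge0 ?lik_ge0// prior_ge0.
Qed.

Lemma measurable_rtg k d (T : measurableType d) (H : T -> hist) (phi : T -> state) :
  hmeas H -> coord_meas phi -> measurable_fun setT (fun t => rtg k (phi t) (H t)).
Proof.
elim: k d T H phi => [|k IH] d T H phi mH mphi; first exact: measurable_cst.
rewrite [X in measurable_fun _ X](_ : _ = (fun t =>
  int_V (fun th => ((phi t (best (phi t)) - phi t (best th)) +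
    \int[mu]_y (normal_pdf (phi t (best th)) sigma y *
                rtg k (phi t) (rcons (H t) (best th, y)))) *
     prior th * lik (H t) th) /
  int_V (fun th => prior th * lik (H t) th))); last by [].
apply: measurable_funM.
  have := @jmeas_int_seq R V d T (fun t th =>
    ((phi t (best (phi t)) - phi t (best th)) +
    \int[mu]_y (normal_pdf (phi t (best th)) sigma y *
                rtg k (phi t) (rcons (H t) (best th, y)))) *
     prior th * lik (H t) th) (enum V).
  move=> /(_ _ _ _ _ idfun (fun _ _ => 0)); apply => //.
    move=> t x; rewrite mulr_ge0 ?lik_ge0// mulr_ge0 ?prior_ge0//.
    rewrite addr_ge0 ?gap_ge0//; apply: Rintegral_ge0 => y _.
    by rewrite mulr_ge0 ?rtg_ge0// normal_pdf_ge0.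
  move=> d' T' u psi mu' mpsi.
  have mphiu : coord_meas (fun t => phi (u t)) by exact: coord_meas_comp.
  have mHu : hmeas (fun t => H (u t)) by exact: hmeas_comp.
  apply: measurable_funM; last exact: measurable_lik.
  apply: measurable_funM; last exact: measurable_prior.
  apply: (@measurable_best R V root pa _ _ psi (fun a t => phi (u t) (best (phi (u t))) - phi (u t) a +
    \int[mu]_y (normal_pdf (phi (u t) a) sigma y *
                rtg k (phi (u t)) (rcons (H (u t)) (a, y))))) => // a.
  apply: measurable_funD.
    apply: measurable_funB; last exact: mphiu.
    exact: (@measurable_best R V root pa _ _ (fun t => phi (u t)) (fun a t => phi (u t) a)).
  apply: (measurableT_comp (fine_measurable measurableT)).
  apply: (measurable_fun_fubini_tonelli_F (m2 := mu)
    (fun p : T' * R => (normal_pdf (phi (u p.1) a) sigma p.2 *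
      rtg k (phi (u p.1)) (rcons (H (u p.1)) (a, p.2)))%:E)).
    apply/measurable_EFinP; apply: measurable_funM.
      apply: measurable_normal_pdf_fun => //.
      by apply: (measurableT_comp (mphiu a)); exact: measurable_fst.
    apply: IH.
      apply: hmeas_rcons; last exact: measurable_snd.
      by apply: (@hmeas_comp _ _ _ _ _ _ fst (fun t => H (u t))).
    by apply: (@coord_meas_comp _ _ _ _ _ _ fst (fun t => phi (u t))).
  by move=> p; rewrite lee_fin mulr_ge0 ?rtg_ge0// normal_pdf_ge0.
  exact: measurable_id.
(* On nonnegative values the inverse is the power with exponent -1, which is a measurable
   function. *)
rewrite [X in measurable_fun _ X](_ : _ = (fun t =>
  powR (int_V (fun th => prior th * lik (H t) th)) (-1))); last first.
  apply/funext => t; rewrite powR_inv1//; apply: int_V_ge0 => x.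
  by rewrite mulr_ge0 ?lik_ge0// prior_ge0.
apply: (measurableT_comp (measurable_powR (-1))).
have := @jmeas_int_seq R V d T (fun t th => prior th * lik (H t) th) (enum V).
move=> /(_ _ _ _ _ idfun (fun _ _ => 0)); apply => //.
  by move=> t x; rewrite mulr_ge0 ?lik_ge0// prior_ge0.
move=> d' T' u psi mu' mpsi; apply: measurable_funM.
  exact: measurable_prior.
  by apply: measurable_lik => //; exact: hmeas_comp.
exact: measurable_id.
Qed.

End RegretMeasurable.

(** * Expectations under the posterior and the one-step gap *)

Section TreeExpectation.
Context {R : realType} {V : finType} (root : V) (pa : V -> V).
Variables (al be sg m t : V -> R) (s : seq V).
Local Notation mu := (@lebesgue_measure R).
Local Notation state := (V -> R).
Local Notation best := (@best R V root pa).

Hypothesis tree : is_rooted_tree root pa.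
Hypothesis al0 : al root = 0.
Hypothesis sg0 : forall i, 0 < sg i.
Hypothesis t0 : forall i, 0 < t i.
Hypothesis tE : forall i, t i ^+ 2 = al i ^+ 2 * t (pa i) ^+ 2 + sg i ^+ 2.
Hypothesis mE : forall i, m i = al i * m (pa i) + be i.
Hypothesis topos : topo root pa s.
Hypothesis perms : perm_eq s (enum V).

Local Notation tg := (tg_pdf pa al be sg s).
Implicit Types f g : state -> R.

Let s_all a : a \in s. Proof. by rewrite (perm_mem perms) mem_enum. Qed.

Definition tgE (f : state -> R) : \bar R :=
  eint s (fun th => (f th)%:E * (tg th)%:E)%E (fun=> 0).

Let cmeas_tg (f : state -> R) : cmeas f ->
  cmeas (fun th => (f th)%:E * (tg th)%:E)%E.
Proof.
move=> mf d T phi mphi; apply: emeasurable_funM; apply/measurable_EFinP.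
  exact: mf.
exact: cmeas_tg_pdf.
Qed.

Let tg_ge0 (f : state -> R) th : (forall th, 0 <= f th) ->
  (0 <= (f th)%:E * (tg th)%:E)%E.
Proof. by move=> f0; rewrite mule_ge0 ?lee_fin ?f0// tg_pdf_ge0. Qed.

Lemma tgE_ge0 f : (forall th, 0 <= f th) -> (0 <= tgE f)%E.
Proof. by move=> f0; apply: eint_ge0 => th; exact: tg_ge0. Qed.

Lemma tgE_le f g : (forall th, 0 <= f th) -> cmeas f -> cmeas g ->
  (forall th, f th <= g th) -> (tgE f <= tgE g)%E.
Proof.
move=> f0 mf mg fg; apply: le_eint => [th|||th].
- exact: tg_ge0.
- exact: cmeas_tg.
- exact: cmeas_tg.
- by rewrite lee_wpmul2r ?lee_fin ?tg_pdf_ge0.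
Qed.

Lemma tgED f g : (forall th, 0 <= f th) -> (forall th, 0 <= g th) ->
  cmeas f -> cmeas g -> tgE (fun th => f th + g th) = (tgE f + tgE g)%E.
Proof.
move=> f0 g0 mf mg; rewrite /tgE -eint_add.
- by apply: eq_eint => th; rewrite EFinD ge0_muleDl// lee_fin.
- by move=> th; exact: tg_ge0.
- by move=> th; exact: tg_ge0.
- exact: cmeas_tg.
- exact: cmeas_tg.
Qed.

Lemma tgEZ c f : 0 <= c -> (forall th, 0 <= f th) -> cmeas f ->
  tgE (fun th => c * f th) = (c%:E * tgE f)%E.
Proof.
move=> c0 f0 mf; rewrite /tgE -eint_scale.
- by apply: eq_eint => th; rewrite EFinM muleA.
- by rewrite lee_fin.
- by move=> th; exact: tg_ge0.
- exact: cmeas_tg.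
Qed.

Lemma cmeas_cst (c : R) : cmeas (fun _ : state => c).
Proof. by move=> d T phi mphi; exact: measurable_cst. Qed.

Lemma tgE_cst c : 0 <= c -> tgE (fun=> c) = c%:E.
Proof.
move=> c0; rewrite /tgE eint_scale.
- rewrite (_ : eint s _ _ = 1%E) ?mule1//; exact: (tg_mass be sg tree al0 (fun=> 0) topos).
- by rewrite lee_fin.
- by move=> th; rewrite lee_fin tg_pdf_ge0.
- by apply: cmeas_EFin; exact: cmeas_tg_pdf.
Qed.

Lemma cmeas_sum (I : Type) (r : seq I) (f : I -> state -> R) :
  (forall i, cmeas (f i)) -> cmeas (fun th => \sum_(i <- r) f i th).
Proof.
by move=> mf d T phi mphi; apply: measurable_sum => i; exact: mf.
Qed.

Lemma tgE_sum (I : Type) (r : seq I) (f : I -> state -> R) :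
  (forall i th, 0 <= f i th) -> (forall i, cmeas (f i)) ->
  tgE (fun th => \sum_(i <- r) f i th) = (\sum_(i <- r) tgE (f i))%E.
Proof.
move=> f0 mf; elim: r => [|i r IH].
  rewrite big_nil -[RHS](tgE_cst (lexx 0)); congr tgE.
  by apply/funext => th; rewrite big_nil.
rewrite big_cons -IH -tgED//.
- by congr tgE; apply/funext => th; rewrite big_cons.
- by move=> th; exact: sumr_ge0.
- exact: cmeas_sum.
Qed.

Lemma tgE_coord a (g : R -> R) : measurable_fun setT g ->
  (forall x, 0 <= g x) -> tgE (fun th => g (th a)) =
  (\int[mu]_x (normal_pdf (m a) (t a) x * g x)%:E)%E.
Proof.
move=> mg g0; rewrite /tgE (@tg_marginal R V root pa al be sg m t tree al0 sg0 t0 tE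
  mE s a _ (EFin \o g) topos)//.
- by apply: eq_integral => x _; rewrite EFinM muleC.
- exact/measurable_EFinP.
Qed.

(** The law of the maximizer under the network; at the posterior it is the law of the optimal action
    and of the sampled action alike. *)
Definition pbest a : R := fine (tgE (fun th => (best th == a)%:R)).

Lemma cmeas_best_eq a : cmeas (fun th : state => (best th == a)%:R : R).
Proof. by move=> d T phi mphi; exact: measurable_best_eq. Qed.

Lemma pbestE a : tgE (fun th => (best th == a)%:R) = (pbest a)%:E.
Proof.
rewrite /pbest fineK// ge0_fin_numE ?tgE_ge0//.
apply: le_lt_trans (ltry 1); rewrite -(tgE_cst ler01); apply: tgE_le => //.
- exact: cmeas_best_eq.
- by move=> th; case: (_ == _).
Qed.

Lemma pbest_ge0 a : 0 <= pbest a.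
Proof. by rewrite -lee_fin -pbestE tgE_ge0. Qed.

Lemma pbest_notleaf a : ~~ is_leaf root pa a -> pbest a = 0.
Proof.
move=> na; rewrite /pbest (_ : (fun th => _) = fun=> 0) ?tgE_cst//.
apply/funext => th; case: eqP => // ba.
by have [] := bestP th tree; rewrite ba (negbTE na).
Qed.

Lemma tgE_best (F : V -> R) : (forall a, 0 <= F a) ->
  tgE (fun th => F (best th)) = (\sum_(a <- enum V) pbest a * F a)%:E.
Proof.
move=> F0.
have -> : (fun th => F (best th)) =
    (fun th : state => \sum_(a <- enum V) F a * (best th == a)%:R).
  apply/funext => th; rewrite (best_sum root pa F).
  by apply: eq_bigr => a _; rewrite mulrC.
rewrite tgE_sum.
- rewrite -sumEFin; apply: eq_bigr => a _.
  rewrite tgEZ//; last exact: cmeas_best_eq.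
  by rewrite pbestE -EFinM mulrC.
- by move=> a th; rewrite mulr_ge0.
- move=> a d T phi mphi; apply: measurable_funM => //; exact: cmeas_best_eq.
Qed.

Lemma pbest_sum : \sum_(a <- enum V) pbest a = 1.
Proof.
apply: EFin_inj; rewrite -(tgE_cst ler01) (@tgE_best (fun=> 1))//.
by congr EFin; apply: eq_bigr => a _; rewrite mulr1.
Qed.

Section Gap.
Variable kap : R.
Hypothesis kap0 : 0 <= kap.

Definition tail_sum : R :=
  \sum_(b in leaves root pa) t b ^+ 2 * normal_pdf (m b) (t b) (m b + kap * t b).

(** With [b = best th], [th b] is at most [m b + kap * t b] plus its excess over this threshold. As
    [b] is random, the excess is bounded by the sum of the positive excesses over all leaves, each a
    one-dimensional Gaussian tail. *)
Lemma tgE_gap a : is_leaf root pa a ->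
  (tgE (fun th => th (best th) - th a)%R <=
   (\sum_(b <- enum V) pbest b * (m b + kap * t b) - m a + tail_sum)%:E)%E.
Proof.
move=> la.
(* [M] makes every term nonnegative, so that the signed inequality
   [th (best th) - th a <= m_b + C_b - m_a - (th a - m_a) + tails], where
   [b = best th], can be integrated with nonnegative integrands only. *)
pose M := \sum_b (`|m b| + kap * t b).
have MC b : m b + kap * t b <= M.
  rewrite /M (bigD1 b)//= -[leLHS]addr0 lerD//.
    by rewrite lerD2r ler_norm.
  by apply: sumr_ge0 => i _; rewrite addr_ge0// mulr_ge0// ltW.
have maM : 0 <= m a + M.
  rewrite /M (bigD1 a)//= addrA addr_ge0//.
    have := ler_norm (- m a); rewrite normrN => h.
    by have := mulr_ge0 kap0 (ltW (t0 a)); lra.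
  by apply: sumr_ge0 => i _; rewrite addr_ge0// mulr_ge0// ltW.
have M0 : 0 <= M.
  by apply: sumr_ge0 => i _; rewrite addr_ge0// mulr_ge0// ltW.
pose gap th : R := th (best th) - th a.
pose pp th : R := Num.max (th a - m a) 0.
pose np th : R := Num.max (m a - th a) 0.
pose bb th : R := M - (m (best th) + kap * t (best th)).
pose tt b th : R := Num.max (th b - m b - kap * t b) 0.
have cm0 b c : cmeas (fun th : state => Num.max (th b - c) 0).
  move=> d T phi mphi; apply: measurable_maxr => //.
  by apply: measurable_funB => //; exact: mphi.
have mgap : cmeas gap.
  move=> d T phi mphi; apply: measurable_funB; last exact: mphi.
  exact: (@measurable_best R V root pa _ _ phi (fun a t => phi t a)).
have mpp : cmeas pp by exact: cm0.
have mnp : cmeas np.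
  move=> d T phi mphi; apply: measurable_maxr => //.
  by apply: measurable_funB => //; exact: mphi.
have mbb : cmeas bb.
  move=> d T phi mphi.
  exact: (@measurable_best R V root pa _ _ phi (fun a _ => M - (m a + kap * t a))).
have mtt b : cmeas (tt b).
  move=> d T phi mphi; apply: measurable_maxr => //.
  by apply: measurable_funB => //; apply: measurable_funB => //; exact: mphi.
have mx0 (x : R) : 0 <= Num.max x 0 by rewrite le_max lexx orbT.
have gap0 th : 0 <= gap th.
  by rewrite subr_ge0; have [_] := bestP th tree; exact.
have bb0 th : 0 <= bb th by rewrite subr_ge0.
have pt th : gap th + (pp th + (bb th + (m a + M))) <=
   2 * M + (np th + \sum_(b <- enum (leaves root pa)) tt b th).
  have lb : best th \in leaves root pa.
    by rewrite inE; have [] := bestP th tree.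
  have tb : th (best th) - m (best th) - kap * t (best th) <=
      \sum_(b <- enum (leaves root pa)) tt b th.
    rewrite big_enum/= (bigD1 (best th))//= -[leLHS]addr0 lerD//.
      by rewrite /tt le_max lexx.
    by apply: sumr_ge0 => b _; exact: mx0.
  have -> : pp th = np th + (th a - m a).
    rewrite /pp /np; case: (lerP (th a) (m a)) => h.
      by rewrite max_r ?subr_le0// max_l ?subr_ge0//; ring.
    by rewrite max_l ?subr_ge0 ?ltW// max_r ?subr_le0 ?ltW//; ring.
  by rewrite /gap /bb; lra.
have msum : cmeas (fun th => \sum_(b <- enum (leaves root pa)) tt b th).
  exact: cmeas_sum.
have mD f g : cmeas f -> cmeas g -> cmeas (fun th : state => f th + g th : R).
  by move=> mf mg d T phi mphi; apply: measurable_funD; [exact: mf|exact: mg].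
have st0 th : 0 <= \sum_(b <- enum (leaves root pa)) tt b th.
  by apply: sumr_ge0 => b _; exact: mx0.
have pp0 th : 0 <= pp th by exact: mx0.
have np0 th : 0 <= np th by exact: mx0.
have m1 := mD _ _ mbb (@cmeas_cst (m a + M)).
have m2 := mD _ _ mpp m1; have m3 := mD _ _ mgap m2.
have m4 := mD _ _ mnp msum; have m5 := mD _ _ (@cmeas_cst (2 * M)) m4.
have p1 th : 0 <= bb th + (m a + M) by rewrite addr_ge0.
have p2 th : 0 <= pp th + (bb th + (m a + M)) by rewrite addr_ge0.
have p3 th : 0 <= gap th + (pp th + (bb th + (m a + M))) by rewrite addr_ge0.
have p4 th : 0 <= np th + \sum_(b <- enum (leaves root pa)) tt b th by rewrite addr_ge0.
have M2 : 0 <= 2 * M by rewrite mulr_ge0.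
have := tgE_le p3 m3 m5 pt.
rewrite (tgED gap0 p2 mgap m2) (tgED pp0 p1 mpp m1).
rewrite (tgED bb0 (fun=> maM) mbb (@cmeas_cst _)).
rewrite (tgED (fun=> M2) p4 (@cmeas_cst _) m4) (tgED np0 st0 mnp msum).
rewrite !tgE_cst// (tgE_sum _ (fun b th => mx0 _) mtt).
(* The positive and negative parts of [th a - m a] stand on opposite sides of the inequality and
   have the same expectation, so they cancel. *)
have -> : tgE pp = (t a ^+ 2 * normal_pdf (m a) (t a) (m a))%:E.
  rewrite (@tgE_coord a (fun x => Num.max (x - m a) 0))//.
    exact: normal_pospart.
  by apply: measurable_maxr => //; exact: measurable_funB.
have -> : tgE np = (t a ^+ 2 * normal_pdf (m a) (t a) (m a))%:E.
  rewrite (@tgE_coord a (fun x => Num.max (m a - x) 0))//.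
    exact: normal_negpart.
  by apply: measurable_maxr => //; exact: measurable_funB.
rewrite (@tgE_best (fun b => M - (m b + kap * t b))); last first.
  by move=> b; rewrite subr_ge0.
move=> h.
have h2 : (\sum_(b <- enum (leaves root pa)) tgE (tt b) <= tail_sum%:E)%E.
  rewrite /tail_sum -big_enum/= -sumEFin; apply: lee_sum => b _.
  rewrite (@tgE_coord b (fun x => Num.max (x - m b - kap * t b) 0))//.
    by apply: normal_tail_le => //; rewrite mulr_ge0// ltW.
  by apply: measurable_maxr => //; do 2 apply: measurable_funB => //.
rewrite -/gap; move: h; set G := t a ^+ 2 * _.
have -> : \sum_(b <- enum V) pbest b * (M - (m b + kap * t b)) =
    M - \sum_(b <- enum V) pbest b * (m b + kap * t b).
  under eq_bigr do rewrite mulrBr.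
  by rewrite sumrB -mulr_suml pbest_sum mul1r.
set Q := \sum_(b <- enum V) _ => h.
rewrite -!EFinD in h.
have {}h := le_trans h (leeD2l _ (leeD2l _ h2)).
rewrite -!EFinD -leeBrDr// -EFinB in h.
apply: le_trans h _; rewrite lee_fin; lra.
Qed.

End Gap.

End TreeExpectation.

(** * Induction on the number of remaining rounds *)

Section RegretInduction.
Context {R : realType} {V : finType} (root : V) (pa : V -> V).
Variables (mu1 : R) (sigma0 : V -> R) (sigma : R).
Hypothesis tree : is_rooted_tree root pa.
Hypothesis sigma0_gt0 : forall i, 0 < sigma0 i.
Hypothesis sigma_gt0 : 0 < sigma.
Local Notation mu := (@lebesgue_measure R).
Local Notation state := (V -> R).
Local Notation hist := (seq (V * R)).
Local Notation best := (@best R V root pa).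
Local Notation leaf := (is_leaf root pa).
Local Notation prior := (prior_pdf root pa mu1 sigma0).
Local Notation lik := (likelihood sigma).
Local Notation rtg := (regret_to_go root pa mu1 sigma0 sigma).
Local Notation EV f := (eint (enum V) f (fun=> 0)).
Local Notation leafy := (all (fun p : V * R => leaf p.1)).
Local Notation post_al := (post_al root pa sigma0 sigma).
Local Notation post_sg := (post_sg root pa sigma0 sigma).
Local Notation post_t := (post_t root pa sigma0 sigma).

Definition joint (h : hist) (th : state) : R := prior th * lik h th.

Lemma joint_ge0 h th : 0 <= joint h th.
Proof. by rewrite mulr_ge0 ?prior_ge0 ?lik_ge0. Qed.

Lemma joint_rcons h a y th :
  joint (rcons h (a, y)) th = joint h th * normal_pdf (th a) sigma y.
Proof. by rewrite /joint lik_rcons mulrA. Qed.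

Lemma measurable_joint d (T : measurableType d) (H : T -> hist) (phi : T -> state) :
  hmeas H -> coord_meas phi -> measurable_fun setT (fun t => joint (H t) (phi t)).
Proof.
move=> mH mphi; apply: measurable_funM; first exact: measurable_prior.
exact: measurable_lik.
Qed.

Lemma cmeas_joint h : cmeas (joint h).
Proof.
by move=> d T phi mphi; apply: measurable_joint => //; exact: hmeas_cst.
Qed.

Lemma posterior_data h : leafy h -> exists Z be m s,
  [/\ 0 < Z, topo root pa s, perm_eq s (enum V),
      forall i, m i = post_al (pulls h) i * m (pa i) + be i &
      forall th, joint h th =
        Z * tg_pdf pa (post_al (pulls h)) be (post_sg (pulls h)) s th].
Proof.
move=> lh; have [s ts ps] := topo_exists tree.
have [Z Z0 ZE] := posterior_factor mu1 tree sigma0_gt0 sigma_gt0 lh.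
pose be := post_be root pa mu1 sigma0 sigma h.
exists Z, be, (path_rec pa (post_al (pulls h)) be #|V|), s; split => //.
  by move=> i; apply: (path_recE tree); exact: post_al_root.
by move=> th; exact: ZE.
Qed.

Definition next_regret k (h : hist) (a : V) (th : state) : R :=
  \int[mu]_y (normal_pdf (th a) sigma y * rtg k th (rcons h (a, y))).

Lemma next_regret_ge0 k h a th : 0 <= next_regret k h a th.
Proof.
by apply: Rintegral_ge0 => y _; rewrite mulr_ge0 ?normal_pdf_ge0// rtg_ge0.
Qed.

Lemma measurable_next k h a d (T : measurableType d) (phi : T -> state) :
  coord_meas phi -> measurable_fun setT (fun p : T * R =>
    normal_pdf (phi p.1 a) sigma p.2 * rtg k (phi p.1) (rcons h (a, p.2))).
Proof.
move=> mphi; apply: measurable_funM.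
  apply: measurable_normal_pdf_fun => //.
  by apply: (measurableT_comp (mphi a)); exact: measurable_fst.
apply: measurable_rtg => //.
  by apply: hmeas_rcons; [exact: hmeas_cst|exact: measurable_snd].
by apply: (@coord_meas_comp _ _ _ _ _ _ fst phi).
Qed.

Lemma cmeas_next_regret k h a : cmeas (next_regret k h a).
Proof.
move=> d T phi mphi.
apply: (measurableT_comp (fine_measurable measurableT)).
apply: (measurable_fun_fubini_tonelli_F (m2 := mu)
  (fun p : T * R => (normal_pdf (phi p.1 a) sigma p.2 *
    rtg k (phi p.1) (rcons h (a, p.2)))%:E)).
  by apply/measurable_EFinP; exact: measurable_next.
by move=> p; rewrite lee_fin mulr_ge0 ?rtg_ge0// normal_pdf_ge0.
Qed.

Lemma jmeas_joint_rcons h a : jmeas (fun y => joint (rcons h (a, y))).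
Proof.
move=> d T u phi mu' mphi; apply: measurable_joint => //.
by apply: hmeas_rcons => //; exact: hmeas_cst.
Qed.

Lemma jmeas_joint_rtg k h a :
  jmeas (fun y th => joint (rcons h (a, y)) th * rtg k th (rcons h (a, y))).
Proof.
move=> d T u phi mu' mphi; apply: measurable_funM.
  exact: jmeas_joint_rcons.
by apply: measurable_rtg => //; apply: hmeas_rcons => //; exact: hmeas_cst.
Qed.

(** Tonelli moves the reward integral outside. Only an inequality results, since [next_regret] is a
    truncated real integral. *)
Lemma EV_next_regret k h a :
  (EV (fun th => (joint h th * next_regret k h a th)%:E) <=
   \int[mu]_y EV (fun th =>
      (joint (rcons h (a, y)) th * rtg k th (rcons h (a, y)))%:E))%E.
Proof.
have F0 y th : (0 <= (joint (rcons h (a, y)) th * rtg k th (rcons h (a, y)))%:E)%E.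
  by rewrite lee_fin mulr_ge0 ?joint_ge0// rtg_ge0.
rewrite -(@eint_integral R V (enum V) (fun y th =>
  (joint (rcons h (a, y)) th * rtg k th (rcons h (a, y)))%:E))//; last first.
  by apply: jmeas_EFin; exact: jmeas_joint_rtg.
apply: le_eint.
- by move=> th; rewrite lee_fin mulr_ge0 ?joint_ge0// next_regret_ge0.
- apply: cmeas_EFin => d T phi mphi; apply: measurable_funM.
    exact: cmeas_joint.
  exact: cmeas_next_regret.
- move=> d T phi mphi.
  apply: (measurable_fun_fubini_tonelli_F (m2 := mu) (fun p : T * R =>
     (joint (rcons h (a, p.2)) (phi p.1) * rtg k (phi p.1) (rcons h (a, p.2)))%:E)) => //.
  apply/measurable_EFinP; apply: (@jmeas_joint_rtg k h a _ _ snd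
    (fun p : T * R => phi p.1)) => //.
  by apply: (@coord_meas_comp _ _ _ _ _ _ fst phi).
- move=> th; under eq_integral do rewrite joint_rcons -mulrA EFinM.
  rewrite ge0_integralZl//.
  + rewrite EFinM lee_wpmul2l ?lee_fin ?joint_ge0//.
    apply: fine_le_ge0; apply: integral_ge0 => y _.
    by rewrite lee_fin mulr_ge0 ?rtg_ge0// normal_pdf_ge0.
  + apply/measurable_EFinP.
    apply: (measurableT_comp (@measurable_next k h a _ R (fun=> th) _)
      (pair1_measurable (0 : R))).
    by move=> i; exact: measurable_cst.
  + by move=> y _; rewrite lee_fin mulr_ge0 ?rtg_ge0// normal_pdf_ge0.
  + by rewrite lee_fin joint_ge0.
Qed.

Lemma EV_joint_rcons h a :
  (\int[mu]_y EV (fun th => (joint (rcons h (a, y)) th)%:E) =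
   EV (fun th => (joint h th)%:E))%E.
Proof.
rewrite -(@eint_integral R V (enum V) (fun y th => (joint (rcons h (a, y)) th)%:E))//;
  last 2 first.
- by move=> y th; rewrite lee_fin joint_ge0.
- by apply: jmeas_EFin; exact: jmeas_joint_rcons.
apply: eq_eint => th; under eq_integral do rewrite joint_rcons EFinM.
rewrite ge0_integralZl//.
- by rewrite integral_normal_pdf mule1.
- by apply/measurable_EFinP; exact: measurable_normal_pdf.
- by move=> y _; rewrite lee_fin normal_pdf_ge0.
- by rewrite lee_fin joint_ge0.
Qed.

Section Step.
Variables (h : hist) (Z : R) (be m : V -> R) (s : seq V).
Local Notation N := (pulls h).
Local Notation tg := (tg_pdf pa (post_al N) be (post_sg N) s).
Hypothesis Z_gt0 : 0 < Z.
Hypothesis topos : topo root pa s.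
Hypothesis perms : perm_eq s (enum V).
Hypothesis mE : forall i, m i = post_al N i * m (pa i) + be i.
Hypothesis jointE : forall th, joint h th = Z * tg th.

Let al0 := post_al_root root pa sigma0 sigma N.
Let sg0 := post_sg_gt0 root pa sigma sigma0_gt0 N.
Local Notation E := (tgE pa (post_al N) be (post_sg N) s).
Local Notation p := (pbest root pa (post_al N) be (post_sg N) s).

Lemma EV_tgE (f : state -> R) : (forall th, 0 <= f th) -> cmeas f ->
  EV (fun th => (joint h th * f th)%:E) = (Z%:E * E f)%E.
Proof.
move=> f0 mf; rewrite /tgE -eint_scale.
- rewrite -(@eint_perm R V s (enum V))//.
  + by apply: eq_eint => th; rewrite jointE mulrAC -mulrA EFinM.
  + exact: topo_uniq topos.
  + by move=> th; rewrite lee_fin mulr_ge0 ?joint_ge0.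
  + apply: cmeas_EFin => d T phi mphi; apply: measurable_funM; last exact: mf.
    exact: cmeas_joint.
- by rewrite lee_fin ltW.
- by move=> th; rewrite mule_ge0 ?lee_fin// tg_pdf_ge0.
- move=> d T phi mphi; apply: emeasurable_funM; apply/measurable_EFinP.
    exact: mf.
  by apply: cmeas_tg_pdf => //; exact: post_sg_gt0.
Qed.

Lemma EV_joint : EV (fun th => (joint h th)%:E) = Z%:E.
Proof.
have := EV_tgE (fun=> ler01) (@cmeas_cst R V 1).
rewrite (tgE_cst be tree al0 sg0 topos ler01) mule1 => <-.
by apply: eq_eint => th; rewrite mulr1.
Qed.

Lemma int_V_joint : int_V (joint h) = Z.
Proof.
apply: EFin_inj; rewrite /int_V int_seq_eint.
- exact: EV_joint.
- exact: joint_ge0.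
- exact: cmeas_joint.
- by rewrite [X in (X < _)%E]EV_joint ltry.
Qed.

(** The true parameter [th] stays fixed while the posterior sample is averaged out; the sampled
    action then has law [p]. *)
Lemma rtg_step k th : rtg k.+1 th h <=
  \sum_(a <- enum V) p a * ((th (best th) - th a) + next_regret k h a th).
Proof.
pose F a := (th (best th) - th a) + next_regret k h a th.
have F0 a : is_leaf root pa a -> 0 <= F a.
  move=> la; rewrite addr_ge0 ?next_regret_ge0// subr_ge0.
  by have [_] := bestP th tree; exact.
(* Off the leaves [F] may be negative. Setting it to 0 there changes nothing at [best th'], which is
   always a leaf. *)
pose G a := if leaf a then F a else 0.
have G0 a : 0 <= G a by rewrite /G; case: ifP => // /F0.
have FG th' : F (best th') = G (best th').
  by rewrite /G; have [->] := bestP th' tree.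
have num0 th' : 0 <= F (best th') * prior th' * lik h th'.
  by rewrite FG mulr_ge0 ?lik_ge0// mulr_ge0 ?prior_ge0.
have mnum : cmeas (fun th' => F (best th') * prior th' * lik h th').
  move=> d T phi mphi; apply: measurable_funM.
    apply: measurable_funM; last exact: measurable_prior.
    exact: (@measurable_best R V root pa _ _ phi (fun a _ => F a)).
  by apply: measurable_lik => //; exact: hmeas_cst.
rewrite -[leLHS]/(int_V (fun th' => F (best th') * prior th' * lik h th') /
  int_V (joint h)) int_V_joint ler_pdivrMr//.
rewrite -lee_fin; apply: (le_trans (int_seq_le_eint _ _ num0 mnum)).
have -> : (EFin \o (fun th' => F (best th') * prior th' * lik h th')) =
    (fun th' => (joint h th' * G (best th'))%:E).
  by apply/funext => th' /=; rewrite FG /joint -mulrA mulrC.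
rewrite (@EV_tgE (fun th' => G (best th')))//; last first.
  move=> d T phi mphi.
  exact: (@measurable_best R V root pa _ _ phi (fun a _ => G a)).
rewrite (tgE_best be tree al0 sg0 topos G0)//.
rewrite -EFinM mulrC lee_fin; apply: ler_wpM2r; first exact: ltW.
apply: ler_sum => a _; rewrite /G; case: ifPn => // na.
by rewrite (pbest_notleaf be tree al0 sg0 topos na) !mul0r.
Qed.

End Step.

Lemma pulls_rcons (h : hist) a y : pulls (rcons h (a, y)) = (fun b => (pulls h b + (b == a))%N).
Proof.
by apply/funext => b; rewrite /pulls -cats1 count_cat/= addn0 (eq_sym a).
Qed.

Section Bound.
Variables (kap eps : R) (n : nat) (U : nat -> (V -> nat) -> R).
Hypothesis kap_ge0 : 0 <= kap.
Hypothesis U_ge0 : forall k h, leafy h -> (size h + k <= n)%N -> 0 <= U k (pulls h).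
Hypothesis U_step : forall k h a, leafy h -> (size h + k < n)%N -> leaf a ->
  kap * post_t (pulls h) a + U k (fun b => (pulls h b + (b == a))%N) + eps
    <= U k.+1 (pulls h).
Hypothesis tail_le : forall (N : V -> nat) (m : V -> R),
  tail_sum root pa m (post_t N) kap <= eps.

(** [U] is a supersolution of the recursion for the regret to go: by [U_step] it pays in each round
    for [kap] times the posterior deviation, the tail [eps] and its own next value. As it sees only
    pull counts, it is constant in the next reward. *)
Lemma EV_joint_rtg k h : leafy h -> (size h + k <= n)%N ->
  (EV (fun th => (joint h th * rtg k th h)%:E) <=
   EV (fun th => (joint h th)%:E) * (U k (pulls h))%:E)%E.
Proof.
elim: k h => [|k IH] h lh hn.
  rewrite (_ : EV _ = 0%E); last first.
    rewrite -(mule0 (EV (fun th => (joint h th)%:E))) muleC -eint_scale//.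
    - by apply: eq_eint => th; rewrite mulr0 mul0e.
    - by move=> th; rewrite lee_fin joint_ge0.
    - by apply: cmeas_EFin; exact: cmeas_joint.
  rewrite mule_ge0 ?lee_fin ?U_ge0//; apply: eint_ge0 => th.
  by rewrite lee_fin joint_ge0.
have [Z [be [m [s [Z0 ts ps mE ZE]]]]] := posterior_data lh.
set N := pulls h in mE ZE *.
have al0 := post_al_root root pa sigma0 sigma N.
have sg0 := post_sg_gt0 root pa sigma sigma0_gt0 N.
have t0 := post_t_gt0 sigma tree sigma0_gt0 N.
have tE := post_tE sigma tree sigma0_gt0 N.
pose E := tgE pa (post_al N) be (post_sg N) s.
pose p := pbest root pa (post_al N) be (post_sg N) s.
have p0 a : 0 <= p a by exact: (pbest_ge0 be tree al0 sg0 ts).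
have psum : \sum_(a <- enum V) p a = 1 by exact: (pbest_sum be tree al0 sg0 ts).
rewrite (EV_joint Z0 ts ps ZE).
have mrtg k' : cmeas (fun th => rtg k' th h).
  by move=> d T phi mphi; apply: measurable_rtg => //; exact: hmeas_cst.
rewrite (EV_tgE Z0 ts ps ZE) => [||]; last 2 first.
- by move=> th; exact: rtg_ge0.
- exact: mrtg.
rewrite lee_wpmul2l ?lee_fin ?(ltW Z0)//.
pose gap a th : R := th (best th) - th a.
have mgap a : cmeas (gap a).
  move=> d T phi mphi; apply: measurable_funB; last exact: mphi.
  exact: (@measurable_best R V root pa _ _ phi (fun a t => phi t a)).
pose G a th := if leaf a then gap a th + next_regret k h a th else 0.
have G0 a th : 0 <= G a th.
  rewrite /G; case: ifP => // la; rewrite addr_ge0 ?next_regret_ge0// subr_ge0.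
  by have [_] := bestP th tree; exact.
have mG a : cmeas (G a).
  move=> d T phi mphi; rewrite /G; case: (leaf a) => //.
  apply: measurable_funD; first exact: mgap.
  exact: cmeas_next_regret.
have mpG a : cmeas (fun th => p a * G a th).
  by move=> d T phi mphi; apply: measurable_funM => //; exact: mG.
apply: (@le_trans _ _ (E (fun th => \sum_(a <- enum V) p a * G a th))).
  apply: (tgE_le pa (post_al N) be s sg0 _ (@mrtg k.+1) (cmeas_sum _ mpG)).
    by move=> th; exact: rtg_ge0.
  - move=> th; apply: (le_trans (rtg_step Z0 ts ps ZE k th)).
    apply: ler_sum => a _; rewrite /G; case: ifPn => // na.
    by rewrite mulr0 (pbest_notleaf be tree al0 sg0 ts na) mul0r.
rewrite /E (tgE_sum be tree al0 sg0 ts)//; last by move=> a th; rewrite mulr_ge0.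
pose S := \sum_(b <- enum V) p b * (m b + kap * post_t N b).
pose Q := tail_sum root pa m (post_t N) kap.
pose N' a := (fun b => (N b + (b == a))%N).
apply: (@le_trans _ _ (\sum_(a <- enum V) p a * (S - m a + Q + U k (N' a)))%:E).
  rewrite -sumEFin; apply: lee_sum => a _; rewrite tgEZ//.
  have [la|na] := boolP (leaf a); last first.
    by rewrite /p (pbest_notleaf be tree al0 sg0 ts na) mul0e mul0r.
  rewrite EFinM lee_wpmul2l ?lee_fin//.
  rewrite (_ : G a = fun th => gap a th + next_regret k h a th); last first.
    by apply/funext => th; rewrite /G la.
  have gap0 th : 0 <= gap a th.
    by rewrite subr_ge0; have [_] := bestP th tree; exact.
  rewrite (tgED pa (post_al N) be s sg0 gap0 (next_regret_ge0 k h a) (mgap a)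
    (@cmeas_next_regret k h a)).
  rewrite EFinD; apply: leeD.
    exact: (tgE_gap tree al0 sg0 t0 tE mE ts ps kap_ge0 la).
  have mjoint : measurable_fun setT
      (fun y => EV (fun th => (joint (rcons h (a, y)) th)%:E)).
    apply: (measurable_eint (F := fun y th => (joint (rcons h (a, y)) th)%:E)).
      by move=> y th; rewrite lee_fin joint_ge0.
    by apply: jmeas_EFin; exact: jmeas_joint_rcons.
  (* Multiplication by [Z] returns to the joint density, where the induction hypothesis applies for
     each value of the next reward; [Z] is positive and is cancelled afterwards. *)
  have Zn : (Z%:E * E (next_regret k h a) <= Z%:E * (U k (N' a))%:E)%E.
    rewrite -(EV_tgE Z0 ts ps ZE); last 2 first.
    - by move=> th; exact: next_regret_ge0.
    - exact: cmeas_next_regret.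
    apply: (le_trans (EV_next_regret k h a)).
    have lh' y : leafy (rcons h (a, y)) by rewrite all_rcons/= la.
    have hn' y : (size (rcons h (a, y)) + k <= n)%N by rewrite size_rcons; lia.
    apply: (@le_trans _ _ (\int[mu]_y (EV (fun th => (joint (rcons h (a, y)) th)%:E) *
        (U k (N' a))%:E))%E).
      apply: ge0_le_integral => //.
      + move=> y _; apply: eint_ge0 => th.
        by rewrite lee_fin mulr_ge0 ?joint_ge0// rtg_ge0.
      + apply: (measurable_eint (F := fun y th => (joint (rcons h (a, y)) th *
          rtg k th (rcons h (a, y)))%:E)).
          by move=> y th; rewrite lee_fin mulr_ge0 ?joint_ge0// rtg_ge0.
        by apply: jmeas_EFin; exact: jmeas_joint_rtg.
      + exact: emeasurable_funM.
      + move=> y _; have := IH _ (lh' y) (hn' y).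
        by rewrite pulls_rcons.
    rewrite ge0_integralZr//.
    + by rewrite EV_joint_rcons (EV_joint Z0 ts ps ZE).
    + by move=> y _; apply: eint_ge0 => th; rewrite lee_fin joint_ge0.
    + by rewrite lee_fin /N' /N -(pulls_rcons h a 0) U_ge0.
  by move: Zn; rewrite lee_pmul2l// lte_fin.
rewrite lee_fin.
(* Here the means cancel: the weights [p] sum to 1, and the same [p] weights the optimal action
   inside [S] and the sampled action [a]. *)
have -> : \sum_(a <- enum V) p a * (S - m a + Q + U k (N' a)) =
    \sum_(a <- enum V) p a * (kap * post_t N a + U k (N' a) + Q).
  apply/eqP; rewrite -subr_eq0 -sumrB.
  have -> : \sum_(a <- enum V) (p a * (S - m a + Q + U k (N' a)) -
     p a * (kap * post_t N a + U k (N' a) + Q)) =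
     \sum_(a <- enum V) (p a * S - p a * (m a + kap * post_t N a)).
    by apply: eq_bigr => a _; ring.
  by rewrite sumrB -mulr_suml psum mul1r subrr.
apply: (@le_trans _ _ (\sum_(a <- enum V) p a * U k.+1 N)); last first.
  by rewrite -mulr_suml psum mul1r.
apply: ler_sum => a _; have [la|na] := boolP (leaf a); last first.
  by rewrite /p (pbest_notleaf be tree al0 sg0 ts na) !mul0r.
apply: ler_wpM2l => //; apply: le_trans (U_step lh _ la); last by lia.
by rewrite lerD2l; exact: tail_le.
Qed.

End Bound.

End RegretInduction.

(** * Threshold, potential and choice of the multiplier *)

Section RegretBound.
Context {R : realType} {V : finType} (root : V) (pa : V -> V).
Variables (mu1 : R) (sigma0 : V -> R) (sigma : R) (n : nat) (c delta : R).
Hypothesis tree : is_rooted_tree root pa.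
Hypothesis sigma0_gt0 : forall i, 0 < sigma0 i.
Hypothesis sigma_gt0 : 0 < sigma.
Local Notation leaf := (is_leaf root pa).
Local Notation s2 i := (sigma0 i ^+ 2).
Local Notation S N i := (stat_fuel root pa sigma0 sigma #|V| N i).
Local Notation leafy := (all (fun p : V * R => leaf p.1)).
Local Notation post_t := (post_t root pa sigma0 sigma).
Local Notation bound := (stat_bound root pa sigma0 sigma n).
Local Notation kappa := (kappa sigma0 sigma).
Local Notation hgt := (height root pa).
Local Notation hist := (seq (V * R)).

Lemma EV_prior :
  eint (enum V) (fun th => (joint root pa mu1 sigma0 sigma [::] th)%:E) (fun=> 0)
  = 1%E.
Proof.
have [s ts ps] := topo_exists tree.
pose al i : R := if i == root then 0 else 1.
pose be i : R := if i == root then mu1 else 0.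
have jE : joint root pa mu1 sigma0 sigma [::] = tg_pdf pa al be sigma0 s.
  apply/funext => th; rewrite /joint /likelihood big_nil mulr1 /tg_pdf.
  rewrite (perm_big _ ps)/= big_enum/=; apply: eq_bigr => i _.
  rewrite /tg_node /al /be; case: ifP => _; first by rewrite mul0r add0r.
  by rewrite mul1r addr0.
rewrite -(@eint_perm R V s (enum V))//.
- by rewrite jE; apply: (@tg_mass R V root pa al) => //; rewrite /al eqxx.
- exact: topo_uniq ts.
- by move=> th; rewrite lee_fin joint_ge0.
- by apply: cmeas_EFin; exact: cmeas_joint.
Qed.

Hypothesis delta01 : 0 < delta <= 1.
Let L := ln (delta^-1).
Let kap := Num.sqrt (2 * L).

Let L_ge0 : 0 <= L.
Proof.
by case/andP: delta01 => d0 d1; rewrite ln_ge0// invf_ge1.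
Qed.

(** Since [kap ^+ 2 / 2 = ln (delta^-1)], each tail equals the posterior deviation times
    [delta / sqrt (2 pi)]. Replacing [1 / sqrt (2 pi)] by [sqrt (2 / pi)] gives away a factor 2. *)
Lemma tail_sum_le (N : V -> nat) (m : V -> R) :
  tail_sum root pa m (post_t N) kap <=
  Num.sqrt (2 / pi) * sigma_max root pa sigma0 * (#|leaves root pa|)%:R * delta.
Proof.
case/andP: delta01 => d0 d1.
have pi0 := pi_gt0 R.
have peak : (Num.sqrt (pi *+ 2))^-1 <= Num.sqrt (2 / pi) :> R.
  rewrite -sqrtrV; last by rewrite mulrn_wge0// ltW.
  rewrite ler_sqrt; last by rewrite divr_ge0// ltW.
  rewrite [leRHS]mulrC (_ : (pi *+ 2)^-1 = pi^-1 * 2^-1 :> R).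
    by rewrite ler_pM2l ?invr_gt0//; lra.
  by rewrite -(mulr_natr pi) invfM.
rewrite /tail_sum.
apply: (@le_trans _ _ (\sum_(b in leaves root pa)
    Num.sqrt (2 / pi) * sigma_max root pa sigma0 * delta)); last first.
  by rewrite sumr_const -[leLHS]mulr_natr mulrAC.
apply: ler_sum => b; rewrite inE => lb.
have tb := post_t_gt0 sigma tree sigma0_gt0 N b.
rewrite normal_tail_peak//.
have -> : - (kap * post_t N b) ^+ 2 / (post_t N b ^+ 2 *+ 2) = - L.
  rewrite exprMn sqr_sqrtr ?mulr_ge0//; field.
  by rewrite gt_eqF.
rewrite expRN lnK ?posrE ?invr_gt0// invrK ler_wpM2r ?(ltW d0)// mulrC.
apply: ler_pM => //; first exact: ltW.
exact: post_t_le_max.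
Qed.

Hypothesis n_gt0 : (0 < n)%N.
Hypothesis c_gt0 : 0 < c.
Hypothesis prec_le : forall (N : V -> nat) (a : V), a \in leaves root pa ->
     (\sum_(b in leaves root pa) N b < n)%N ->
     forall i : V,
       hat_prec root pa sigma0 sigma (fun b => (N b + (b == a))%N) i
       <= c * hat_prec root pa sigma0 sigma N i.

Let s2_gt0 i : 0 < s2 i. Proof. by rewrite exprn_gt0. Qed.

(** A pull never lowers a precision, so the ratio bound at the zero counts, admissible because
    [0 < n], already forces this. *)
Lemma prec_ratio_ge1 : 1 <= c.
Proof.
have [a la] := leaf_exists tree.
have := @prec_le (fun=> 0%N) a; rewrite inE big1// => /(_ la n_gt0 root) h.
set N' := (fun b => _) in h.
have h0 : 0 < hat_prec root pa sigma0 sigma (fun=> 0%N) root.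
  by rewrite /hat_prec ltr_pwDl ?invr_gt0// stat_ge0.
have : hat_prec root pa sigma0 sigma (fun=> 0%N) root <=
  hat_prec root pa sigma0 sigma N' root by rewrite lerD2l stat_mono.
by move=> /le_trans /(_ h); rewrite ler_pMl.
Qed.

(* [ln (1 + s2 i * S N i)] is the logarithm of the conditional posterior precision
   of [i] relative to its prior precision. *)
Definition potential (N : V -> nat) : R :=
  \sum_i c ^+ hgt i * (kappa i * (ln (1 + bound i) - ln (1 + s2 i * S N i))).

Lemma sum_pulls (h : hist) : (\sum_(b in leaves root pa) pulls h b <= size h)%N.
Proof.
elim: h => [|p h IH]; first by rewrite big1.
rewrite /pulls/= big_split/= -add1n leq_add//.
have [pl|pl] := boolP (p.1 \in leaves root pa); last first.
  by rewrite big1// => b bl; case: eqP => // pb; rewrite pb bl in pl.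
by rewrite (bigD1 p.1)//= eqxx big1// => b /andP[_]; rewrite eq_sym => /negbTE ->.
Qed.

Lemma potential_ge0 (h : hist) : (size h <= n)%N -> 0 <= potential (pulls h).
Proof.
move=> hn; apply: sumr_ge0 => i _.
rewrite mulr_ge0 ?exprn_ge0 ?(ltW c_gt0)//.
rewrite mulr_ge0 ?(ltW (kappa_gt0 sigma0_gt0 sigma_gt0 i))//.
have P0 := stat_1p_gt0 root pa sigma sigma0_gt0 (pulls h) i.
have le : s2 i * S (pulls h) i <= bound i.
  apply: stat_le_bound => // a _; exact: leq_trans (count_size _ _) hn.
rewrite subr_ge0 ler_ln ?posrE//; first by rewrite lerD2l.
by apply: lt_le_trans P0 _; rewrite lerD2l.
Qed.

Lemma potential_step (h : hist) a : (size h < n)%N -> leaf a ->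
  post_t (pulls h) a ^+ 2 <=
  potential (pulls h) - potential (fun b => (pulls h b + (b == a))%N).
Proof.
move=> hn la; set N := pulls h; set N' := (fun b => _).
have -> : potential N - potential N' = \sum_i gain root pa sigma0 sigma c N N' i.
  by rewrite /potential -sumrB; apply: eq_bigr => i _; rewrite /gain; ring.
rewrite (sqr_post_t _ tree)//.
apply: (t2_le_gain tree sigma0_gt0 sigma_gt0 (al := post_al root pa sigma0 sigma N)).
- by move=> j; rewrite leq_addr.
- exact: prec_ratio_ge1.
- by apply: prec_le; rewrite ?inE//; apply: leq_ltn_trans hn; exact: sum_pulls.
- by move=> i ir; rewrite /post_al (negbTE ir).
- exact: post_al_root.
- by move=> i; rewrite (post_t2E _ _ tree) /shr [in LHS](mulrC _ (s2 i)).
- exact: la.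
- by rewrite /N' eqxx addn1.
Qed.

(** Applying [2 t <= lam t^2 + 1/lam] to [kap * t], each round spends [kap / 2 * lam] times the drop
    of the potential, plus the fixed cost [kap / (2 * lam) + eps]. *)
Definition to_go_bound (lam eps : R) (k : nat) (N : V -> nat) : R :=
  kap / 2 * (lam * potential N + k%:R / lam) + k%:R * eps.

Lemma bayes_regret_le lam : 0 < lam ->
  bayes_regret root pa mu1 sigma0 sigma n <=
  to_go_bound lam (Num.sqrt (2 / pi) * sigma_max root pa sigma0 *
    (#|leaves root pa|)%:R * delta) n (fun=> 0%N).
Proof.
move=> lam0; set eps := _ * delta.
have sm0 : 0 <= sigma_max root pa sigma0.
  have [a la] := leaf_exists tree.
  apply: le_trans (post_t_le_max sigma tree sigma0_gt0 (fun=> 0%N) la).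
  by rewrite ltW// post_t_gt0.
have eps0 : 0 <= eps.
  by case/andP: delta01 => d0 _; rewrite !mulr_ge0 ?sqrtr_ge0// ltW.
have k0 : 0 <= kap by exact: sqrtr_ge0.
have U0 k h : leafy h -> (size h + k <= n)%N ->
    0 <= to_go_bound lam eps k (pulls h).
  move=> lh hn; apply: addr_ge0; last exact: mulr_ge0.
  apply: mulr_ge0; first exact: divr_ge0.
  apply: addr_ge0; last by rewrite divr_ge0// ltW.
  by apply: mulr_ge0; [exact: ltW|apply: potential_ge0; lia].
have Us k h a : leafy h -> (size h + k < n)%N -> leaf a ->
    kap * post_t (pulls h) a +
    to_go_bound lam eps k (fun b => (pulls h b + (b == a))%N) + eps
    <= to_go_bound lam eps k.+1 (pulls h).
  move=> lh hn la.
  have hn' : (size h < n)%N by lia.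
  have pot := potential_step hn' la.
  rewrite /to_go_bound -[k.+1]addn1 natrD.
  set t := post_t _ _ in pot *; set P := potential _ in pot *.
  set P' := potential _ in pot *.
  (* AM-GM: [2 t <= lam t^2 + 1/lam] *)
  have amgm : 2 * t <= lam * (P - P') + lam^-1.
    apply: (@le_trans _ _ (lam * t ^+ 2 + lam^-1)); last by rewrite lerD2r ler_pM2l.
    rewrite -subr_ge0.
    have -> : lam * t ^+ 2 + lam^-1 - 2 * t = lam * (t - lam^-1) ^+ 2.
      by field; rewrite gt_eqF.
    by rewrite mulr_ge0 ?sqr_ge0// ltW.
  have := ler_wpM2l (divr_ge0 k0 (ler0n _ 2)) amgm.
  set A := k%:R / lam.
  rewrite (mulrDl _ _ lam^-1) -/A !mul1r; lra.
have := EV_joint_rtg mu1 tree sigma0_gt0 sigma_gt0 k0 U0 Us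
  (@tail_sum_le) (h := [::]) (k := n).
rewrite EV_prior mul1e add0n => /(_ isT (leqnn n)) main.
rewrite -lee_fin; apply: le_trans main.
rewrite /bayes_regret.
apply: (le_trans (int_seq_le_eint _ _ _ _)).
- by move=> th; rewrite mulr_ge0 ?prior_ge0// rtg_ge0.
- move=> d T phi mphi; apply: measurable_funM; first exact: measurable_prior.
  by apply: measurable_rtg => //; exact: hmeas_nil.
- rewrite le_eqVlt; apply/orP; left; apply/eqP; apply: eq_eint => th /=.
  by rewrite /joint /likelihood big_nil mulr1.
Qed.

Lemma potential0 : potential (fun=> 0%N) = G_n root pa sigma0 sigma c n.
Proof.
apply: eq_bigr => i _; rewrite stat0 mulr0 addr0 ln1 subr0.
by rewrite /w_node /kappa /stat_bound.
Qed.

(** The term of an action node is positive because [0 < n]; the optimal multiplier divides by the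
    square root of this sum. *)
Lemma G_n_gt0 : 0 < G_n root pa sigma0 sigma c n.
Proof.
rewrite -potential0; have [a la] := leaf_exists tree.
have P0 i : 0 <= bound i.
  by have := @stat_le_bound R V root pa sigma0 sigma tree sigma0_gt0 sigma_gt0 n
    (fun=> 0%N) i (fun _ _ => leq0n n); rewrite stat0 mulr0.
have term i : 0 <= c ^+ hgt i * (kappa i * (ln (1 + bound i) -
    ln (1 + s2 i * S (fun=> 0%N) i))).
  rewrite stat0 mulr0 addr0 ln1 subr0 mulr_ge0 ?exprn_ge0 ?(ltW c_gt0)//.
  by rewrite mulr_ge0 ?(ltW (kappa_gt0 _ _ _))// ln_ge0// lerDl.
rewrite /potential (bigD1 a)//= ltr_pwDl// ?sumr_ge0//.
rewrite stat0 mulr0 addr0 ln1 subr0 mulr_gt0 ?exprn_gt0// mulr_gt0 ?kappa_gt0//.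
by rewrite ln_gt0// ltrDl /stat_bound la !mulr_gt0 ?ltr0n// invr_gt0 exprn_gt0.
Qed.

Lemma bayes_regret_bound :
  bayes_regret root pa mu1 sigma0 sigma n
  <= Num.sqrt (2 * n%:R * G_n root pa sigma0 sigma c n * L)
     + Num.sqrt (2 / pi) * sigma_max root pa sigma0 * (#|leaves root pa|)%:R
       * n%:R * delta.
Proof.
have G0 := G_n_gt0; set G := G_n _ _ _ _ _ _ in G0 *.
have sn : 0 < Num.sqrt (n%:R : R) by rewrite sqrtr_gt0 ltr0n.
have sG : 0 < Num.sqrt G by rewrite sqrtr_gt0.
(* The choice [lam = sqrt n / sqrt G] makes [lam * G] and [n / lam] both equal to [sqrt (n * G)]. *)
apply: le_trans (bayes_regret_le (divr_gt0 sn sG)) _.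
rewrite /to_go_bound potential0 -/G le_eqVlt; apply/orP; left; apply/eqP.
congr (_ + _); last by ring.
have -> : 2 * n%:R * G * L = 2 * L * (n%:R * G) by ring.
rewrite sqrtrM ?mulr_ge0// -/kap sqrtrM ?ler0n//.
have nE := sqr_sqrtr (ler0n R n); have GE := sqr_sqrtr (ltW G0).
move: (Num.sqrt n%:R) (Num.sqrt G) sn sG nE GE => x y x0 y0 <- <-.
by field; rewrite !gt_eqF.
Qed.

End RegretBound.

Local Close Scope classical_set_scope.
Unset Implicit Arguments.

Theorem theorem1 (R : realType) (V : finType) (root : V) (pa : V -> V)
  (mu1 : R) (sigma0 : V -> R) (sigma : R) (n : nat) (c delta : R) :
  is_rooted_tree root pa ->
  (forall i, 0 < sigma0 i) -> 0 < sigma ->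
  0 < c ->
  (forall (N : V -> nat) (a : V), a \in leaves root pa ->
     (\sum_(b in leaves root pa) N b < n)%N ->
     forall i : V,
       hat_prec root pa sigma0 sigma (fun b => (N b + (b == a))%N) i
       <= c * hat_prec root pa sigma0 sigma N i) ->
  0 < delta <= 1 ->
  bayes_regret root pa mu1 sigma0 sigma n
  <= Num.sqrt (2 * n%:R * G_n root pa sigma0 sigma c n * ln (delta^-1))
     + Num.sqrt (2 / pi) * sigma_max root pa sigma0 * (#|leaves root pa|)%:R
       * n%:R * delta.
Proof.
move=> tree sigma0_gt0 sigma_gt0 c_gt0 prec_le delta01.
(* For [n = 0] the optimal multiplier would be 0; both sides of the bound vanish and this case is
   settled directly. *)
have [n0|n_gt0] := posnP n; last exact: bayes_regret_bound.
rewrite n0 /= mulr0 !mul0r sqrtr0 add0r mulr0 mul0r /bayes_regret.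
rewrite (_ : (fun _ => _) = fun=> 0) ?/int_V ?int_seq0//.
by apply/funext => th; rewrite mulr0.
Qed.
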